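(* Let $\phi$ be an admissible action density which is $\theta$-homogeneous for some $\theta\in(1,p]$, let $\gamma\in\mathcal M^+_{\rm loc}(\mathbb R^d)$ satisfy $\tilde m_r(\gamma)<\infty$ for some $r\in\mathbb R$, let $T>0$, and let $(\mu,\boldsymbol\nu)\in\mathrm{CE}(0,T)$ with $E:=\int_0^T\Phi(\mu_t,\boldsymbol\nu_t|\gamma)\,dt<\infty$. Set $\bar\delta:=\frac p\theta+(1-\frac1\theta)r$. For every $\delta\le\bar\delta$, if $\tilde m_\delta(\mu_0)<\infty$ then $\tilde m_\delta(\mu_t)<\infty$ for all $t\in[0,T]$ and $$\tilde m_\delta(\mu_t)\le C_3\Big(\tilde m_\delta(\mu_0)+\tilde m_r(\gamma)^{1-1/\theta}E^{1/\theta}\Big),$$ for a constant $C_3$ depending only on $\phi,p,\theta,r,\delta,T$. Moreover, if $\bar\delta\ge0$ (i.e. $r\ge-p/(\theta-1)$) and $\mu_0(\mathbb R^d)<\infty$, then $\mu_t(\mathbb R^d)$ is finite and constant in $t\in[0,T]$.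
   Context: Notation: $\mathcal M^+_{\rm loc}(\mathbb R^d)$ is the set of nonnegative Radon measures on $\mathbb R^d$ and $\mathcal M_{\rm loc}(\mathbb R^d;\mathbb R^d)$ the set of $\mathbb R^d$-valued Radon measures, both endowed with the weak$^*$ topology induced by duality with compactly supported continuous functions; $|\boldsymbol\nu|$ is the total variation measure of $\boldsymbol\nu$; $B_R$ is the open ball of radius $R$ centered at $0$; $p\in(1,\infty)$ and $q=p/(p-1)$. An admissible action density is a function $\phi:(0,\infty)\times\mathbb R^d\to[0,\infty)$ which is convex, satisfies $\phi(\rho,\lambda w)=|\lambda|^p\phi(\rho,w)$ for all $\rho>0,\lambda\in\mathbb R,w\in\mathbb R^d$, and for which there is $\rho_0>0$ with $\phi(\rho_0,w)>0$ for all $w\ne0$. It is extended to $\rho=0$ by $\phi(0,w):=\lim_{\rho\downarrow0}\phi(\rho,w)\in[0,\infty]$ (the map $\rho\mapsto\phi(\rho,w)$ is nonincreasing), and its recession function is $\phi^\infty(\rho,w):=\lim_{\lambda\to+\infty}\lambda^{-1}\phi(\lambda\rho,\lambda w)\in[0,\infty]$ for $\rho\ge0$. Action functional: given $\gamma\in\mathcal M^+_{\rm loc}(\mathbb R^d)$, $\mu\in\mathcal M^+_{\rm loc}(\mathbb R^d)$, $\boldsymbol\nu\in\mathcal M_{\rm loc}(\mathbb R^d;\mathbb R^d)$ with $\mathrm{supp}\,\mu,\mathrm{supp}\,\boldsymbol\nu\subset\mathrm{supp}\,\gamma$, write the Lebesgue decompositions $\mu=\rho\gamma+\mu^\perp$,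 $\boldsymbol\nu=w\gamma+\boldsymbol\nu^\perp$, pick any $\sigma\in\mathcal M^+_{\rm loc}(\mathbb R^d)$ with $\mu^\perp=\rho^\perp\sigma$, $\boldsymbol\nu^\perp=w^\perp\sigma$, and set $\Phi(\mu,\boldsymbol\nu|\gamma):=\int\phi(\rho,w)\,d\gamma+\int\phi^\infty(\rho^\perp,w^\perp)\,d\sigma$ (independent of $\sigma$); set $\Phi(\mu,\boldsymbol\nu|\gamma)=+\infty$ if the support condition fails. Continuity equation: for $T>0$, $\mathrm{CE}(0,T)$ is the set of pairs $(\mu,\boldsymbol\nu)$ where $(\mu_t)_{t\in[0,T]}$ is a weakly$^*$ continuous curve in $\mathcal M^+_{\rm loc}(\mathbb R^d)$, $(\boldsymbol\nu_t)_{t\in(0,T)}$ is a Borel family in $\mathcal M_{\rm loc}(\mathbb R^d;\mathbb R^d)$ with $\int_0^T|\boldsymbol\nu_t|(B_R)\,dt<\infty$ for all $R>0$, and $\int_0^T\!\int\partial_t\zeta\,d\mu_t\,dt+\int_0^T\!\int\nabla_x\zeta\cdot d\boldsymbol\nu_t\,dt=0$ for all $\zeta\in C^1_c(\mathbb R^d\times(0,T))$. $\phi$ is called $\theta$-homogeneous if $\phi(\lambda\rho,\lambda w)=\lambda^\theta\phi(\rho,w)$ for all $\lambda,\rho>0$, $w\in\mathbb R^d$. For $\mu\in\mathcal M^+_{\rm loc}(\mathbb R^d)$ and $r\in\mathbb R$, $\tilde m_r(\mu):=\int(1\vee|x|)^r\,d\mu(x)$. *)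

(* Defs.v *)
From HB Require Import structures.
From mathcomp Require Import all_boot all_order all_algebra.
From mathcomp Require Import all_classical all_reals all_analysis.
From mathcomp Require Import measurable_realfun.
Set Implicit Arguments. Unset Strict Implicit. Unset Printing Implicit Defensive.
Import Order.TTheory GRing.Theory Num.Theory.
Import numFieldNormedType.Exports.
Local Open Scope classical_set_scope.
Local Open Scope ring_scope.

Section Defs.
Context (R : realType) (d : nat).

Definition Rd := g_sigma_algebraType (open : set (set 'rV[R]_d)).

Definition enorm (x : 'rV[R]_d) : R := Num.sqrt (\sum_i x ord0 i ^+ 2).
Definition eball (c : 'rV[R]_d) (r : R) : set Rd := [set x | enorm (x - c) < r].
Definition dotv (x y : 'rV[R]_d) : R := \sum_i x ord0 i * y ord0 i.
Definition bounded_set (A : set Rd) := exists r : R, A `<=` eball 0%R r.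

Local Open Scope ereal_scope.

Definition locfin (m : {measure set Rd -> \bar R}) := forall r : R, m (eball 0%R r) < +oo.

Definition mom (r : R) (m : {measure set Rd -> \bar R}) : \bar R :=
  \int[m]_x ((Num.max 1 (enorm x)) `^ r)%:E.

Definition supp (m : {measure set Rd -> \bar R}) : set 'rV[R]_d :=
  [set x | forall e : R, (0 < e)%R -> 0 < m (eball x e)].

(* A vector Radon measure nu is represented as nu = u sig with sig a
   nonnegative Radon measure and u a Borel, locally sig-integrable field;
   then |nu| = |u| sig. *)
Definition vsupp (sig : {measure set Rd -> \bar R}) (u : 'rV[R]_d -> 'rV[R]_d)
  : set 'rV[R]_d :=
  [set x | forall e : R, (0 < e)%R ->
     0 < \int[sig]_(y in eball x e) (enorm (u y))%:E].

Local Close Scope ereal_scope.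

(* admissible action density of exponent p (only values rho > 0 matter) *)
Definition admissible (p : R) (phi : R -> 'rV[R]_d -> R) :=
  [/\ (forall rho w, 0 < rho -> 0 <= phi rho w),
      (forall rho1 rho2 w1 w2 l, 0 < rho1 -> 0 < rho2 -> 0 <= l <= 1 ->
         phi (l * rho1 + (1 - l) * rho2) (l *: w1 + (1 - l) *: w2)
         <= l * phi rho1 w1 + (1 - l) * phi rho2 w2),
      (forall rho l w, 0 < rho -> phi rho (l *: w) = `|l| `^ p * phi rho w) &
      exists2 rho0, 0 < rho0 & forall w, w != 0 -> 0 < phi rho0 w].

Definition homogeneous (theta : R) (phi : R -> 'rV[R]_d -> R) :=
  forall l rho w, 0 < l -> 0 < rho -> phi (l * rho) (l *: w) = l `^ theta * phi rho w.

Local Open Scope ereal_scope.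

Definition phi_ext (phi : R -> 'rV[R]_d -> R) (rho : R) (w : 'rV[R]_d) : \bar R :=
  if (0 < rho)%R then (phi rho w)%:E
  else lim ((fun s : R => (phi s w)%:E) @ 0^'+).

Definition phi_inf (phi : R -> 'rV[R]_d -> R) (rho : R) (w : 'rV[R]_d) : \bar R :=
  lim ((fun l : R => (l^-1)%:E * phi_ext phi (l * rho) (l *: w)) @ +oo%R).

(* Lebesgue decomposition data: mu = rho gamma + rhop s, nu = w gamma + wp s,
   with rhop s and wp s singular w.r.t. gamma. *)
Definition lebdec (gamma mu sig : {measure set Rd -> \bar R})
  (u : 'rV[R]_d -> 'rV[R]_d)
  (rho : Rd -> R) (w : Rd -> 'rV[R]_d) (s : {measure set Rd -> \bar R})
  (rhop : Rd -> R) (wp : Rd -> 'rV[R]_d) :=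
  [/\ measurable_fun setT rho /\ measurable_fun setT rhop,
      (forall i, measurable_fun setT (fun x => w x ord0 i)) /\
      (forall i, measurable_fun setT (fun x => wp x ord0 i)),
      (forall x, 0 <= rho x)%R /\ (forall x, 0 <= rhop x)%R,
      locfin s &
      (forall r : R, gamma.-integrable (eball 0%R r) (fun x => (enorm (w x))%:E)) /\
      (forall r : R, s.-integrable (eball 0%R r) (fun x => (enorm (wp x))%:E))] /\
  [/\ (exists N : set Rd, [/\ measurable N, gamma N = 0,
          \int[s]_(x in ~` N) (rhop x)%:E = 0 &
          \int[s]_(x in ~` N) (enorm (wp x))%:E = 0]),
      (forall A, measurable A ->
          mu A = \int[gamma]_(x in A) (rho x)%:E + \int[s]_(x in A) (rhop x)%:E) &
      (forall A, measurable A -> bounded_set A -> forall i,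
          \int[sig]_(x in A) (u x ord0 i)%:E =
          \int[gamma]_(x in A) (w x ord0 i)%:E + \int[s]_(x in A) (wp x ord0 i)%:E)].

(* Action functional Phi(mu, nu | gamma) with nu = u sig; the value does not
   depend on the decomposition data (paper), we take the infimum over them. *)
Definition Phi (phi : R -> 'rV[R]_d -> R) (gamma mu sig : {measure set Rd -> \bar R})
  (u : 'rV[R]_d -> 'rV[R]_d) : \bar R :=
  if `[< supp mu `<=` supp gamma /\ vsupp sig u `<=` supp gamma >] then
    ereal_inf [set v | exists rho w s rhop wp,
       lebdec gamma mu sig u rho w s rhop wp /\
       v = \int[gamma]_x phi_ext phi (rho x) (w x) +
           \int[s]_x phi_inf phi (rhop x) (wp x)]
  else +oo.

Local Close Scope ereal_scope.

Definition dtime (zeta : 'rV[R]_d -> R -> R) (x : 'rV[R]_d) (t : R) : R :=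
  derive (zeta x) t 1.
Definition grad (zeta : 'rV[R]_d -> R -> R) (x : 'rV[R]_d) (t : R) : 'rV[R]_d :=
  \row_i derive (fun y => zeta y t) x (delta_mx ord0 i).

Definition testfun (T : R) (zeta : 'rV[R]_d -> R -> R) :=
  [/\ (forall x t, derivable (zeta x) t 1),
      (forall x t i, derivable (fun y => zeta y t) x (delta_mx ord0 i)),
      continuous (fun z : 'rV[R]_d * R => zeta z.1 z.2) /\
      continuous (fun z : 'rV[R]_d * R => dtime zeta z.1 z.2),
      (forall i, continuous (fun z : 'rV[R]_d * R => grad zeta z.1 z.2 ord0 i)) &
      exists r a b : R, [/\ 0 < a, a < b, b < T &
        forall x t, r <= enorm x \/ t < a \/ b < t -> zeta x t = 0]].

Local Open Scope ereal_scope.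

Definition CE (T : R) (mu sig : R -> {measure set Rd -> \bar R})
  (u : R -> 'rV[R]_d -> 'rV[R]_d) :=
  [/\ (forall t, `[0%R, T]%classic t -> locfin (mu t)) /\
      (forall f : 'rV[R]_d -> R, continuous f ->
         (exists r : R, forall x, (r <= enorm x)%R -> f x = 0%R) ->
         {within `[0%R, T]%classic, continuous (fun t => \int[mu t]_x (f x)%:E)}),
      (forall t, `]0%R, T[%classic t ->
         [/\ locfin (sig t), (forall i, measurable_fun setT (fun x : Rd => u t x ord0 i)) &
             forall r : R, \int[sig t]_(x in eball 0%R r) (enorm (u t x))%:E < +oo]) /\
      (forall A, measurable A -> bounded_set A -> forall i,
         measurable_fun `]0%R, T[%classic (fun t => (\int[sig t]_(x in A) (u t x ord0 i)%:E : \bar R))),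
      (forall r : R, \int[lebesgue_measure]_(t in `]0%R, T[%classic)
          \int[sig t]_(x in eball 0%R r) (enorm (u t x))%:E < +oo) &
      (forall zeta, testfun T zeta ->
         \int[lebesgue_measure]_(t in `]0%R, T[%classic) \int[mu t]_x (dtime zeta x t)%:E
       + \int[lebesgue_measure]_(t in `]0%R, T[%classic)
             \int[sig t]_x (dotv (grad zeta x t) (u t x))%:E = 0)].

Definition energy (phi : R -> 'rV[R]_d -> R) (gamma : {measure set Rd -> \bar R})
  (T : R) (mu sig : R -> {measure set Rd -> \bar R}) (u : R -> 'rV[R]_d -> 'rV[R]_d)
  : \bar R :=
  \int[lebesgue_measure]_(t in `]0%R, T[%classic) Phi phi gamma (mu t) (sig t) (u t).

End Defs.

(* Main.v *)
(* Homogeneity gives phi(rho, w) = rho^(theta-p) phi(1, w) >= c rho^(theta-p) |w|^p, and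
   phi^infty(rho, w) = +oo for w <> 0, so a flux of finite action has no singular part.
   For a weight psi with |grad psi| <= K psi^(1-theta/p) G^((theta-1)/p), a three-term Young
   inequality bounds |grad psi . w| by alpha phi(rho, w) + beta psi rho + tau G, hence by
   the continuity equation
     |int psi dmu_t - int psi dmu_0| <= alpha E + T (beta max_s int psi dmu_s + tau int G dgamma).
   With s = 1 + |x|^2 the weights are psi_N = s^(delta/2) ((1 - s/N)_+)^(2k).
   For the moments take G = s^(r/2), which is where delta <= p/theta + (1 - 1/theta) r is
   needed; absorb the beta term with beta = 1/(2T), optimise over alpha and tau, and let
   N tend to infinity.
   For the mass (delta = 0) take G_N = (sqrt s / N)^(p/(theta-1)) on {s < N}: it is dominated
   by s^(r/2) and tends to 0, so tau int G_N dgamma vanishes in the limit for every tau, and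
   alpha and beta are then arbitrarily small. *)

Require Import Defs.
From HB Require Import structures.
From mathcomp Require Import all_boot all_order all_algebra.
From mathcomp Require Import all_classical all_reals all_analysis.
From mathcomp Require Import measurable_realfun.
From mathcomp Require Import ring lra.
Set Implicit Arguments. Unset Strict Implicit. Unset Printing Implicit Defensive.
Import Order.TTheory GRing.Theory Num.Theory.
Import numFieldNormedType.Exports.
Local Open Scope classical_set_scope.
Local Open Scope ring_scope.

(** The exponents in the weight condition come from |w| = (rho^(theta-p) |w|^p)^(1/p)
    rho^(1-theta/p): the first factor is paid by the action, the second needs psi^(1-theta/p) to
    become the mass density psi rho, and the exponent (theta-1)/p that is left over goes to G. The
    same power of psi dictates how flat the cutoff must be at its edge. Compact support of psi_N
    also makes the absorption legitimate: its mass curve is finite and continuous, hence has a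
    maximum, whereas the moment itself might a priori be infinite for t > 0. The obstacle is
    measurability: [Phi] is an infimum over decompositions chosen separately at each time. Action
    integrals, over x as well as over t, are therefore bounded from below through an explicit
    measurable minorant, the positive part of (flux minus the other Young terms) divided by alpha.
    Measurability in t is drawn only from [CE], for the flux tested against a fixed function. *)

(** * Seminorms on R^d and comparison with the Euclidean norm *)

Lemma seminorm_le_norm (R : realType) (d : nat) (N : 'rV[R]_d -> R) :
  N 0 = 0 -> (forall x y, N (x + y) <= N x + N y) ->
  (forall a x, N (a *: x) = `|a| * N x) ->
  exists K, forall x, N x <= K * `|x|.
Proof.
move=> N0 ND NZ; have Nge0 x : 0 <= N x.
  have := ND x (- x); rewrite subrr N0 -scaleN1r NZ normrN1 mul1r => h.
  by rewrite -(@pmulr_rge0 _ 2)// mulr_natl mulr2n.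
exists (\sum_(i < d) N (delta_mx ord0 i)) => x.
rewrite {1}(row_sum_delta x) mulr_suml.
elim/big_ind2: _ => [|a b c e ab ce|i _]; first by rewrite N0.
  by apply: le_trans (ND _ _) _; exact: lerD.
rewrite NZ mulrC ler_wpM2l//.
rewrite {2}/Num.norm/= mx_normrE.
by apply: (@le_bigmax_cond _ _ _ _ (ord0, i) _ (fun ij => `|x ij.1 ij.2|)).
Qed.

Lemma norm_continuous_of_seminorm (R : realType) (d : nat) (N : 'rV[R]_d -> R) :
  N 0 = 0 -> (forall x y, N (x + y) <= N x + N y) ->
  (forall a x, N (a *: x) = `|a| * N x) -> continuous N.
Proof.
move=> N0 ND NZ; have [K NK] := seminorm_le_norm N0 ND NZ.
have NN x : N (- x) = N x by rewrite -scaleN1r NZ normrN1 mul1r.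
have lip x y : `|N x - N y| <= `|K| * `|x - y|.
  have h a b : N a - N b <= `|K| * `|a - b|.
    rewrite lerBlDl -{1}(subrKC b a); apply: le_trans (ND _ _) _.
    rewrite lerD2l; apply: le_trans (NK _) _.
    by rewrite ler_wpM2r// ler_norm.
  by rewrite ler_norml h andbT lerNl opprB distrC h.
move=> x; apply: (iffRL (@cvgrPdist_lt _ _ _ (nbhs x) (nbhs_filter x) N (N x))) => e e0.
have K1 : 0 < `|K| + 1 by rewrite ltr_wpDl.
have h : \forall y \near nbhs x, `|x - y| < e / (`|K| + 1).
  apply: (iffRL (@nbhs_normP R 'rV[R]_d x (fun y => `|x - y| < e / (`|K| + 1)))); exists (e / (`|K| + 1)); first exact: divr_gt0.
  by [].
apply: filterS h => y; rewrite ltr_pdivlMr// => h.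
apply: le_lt_trans (lip _ _) _; apply: le_lt_trans h.
by rewrite mulrC ler_wpM2l// lerDl.
Qed.

Lemma enorm_ge0 (R : realType) (d : nat) (x : 'rV[R]_d) : 0 <= enorm x.
Proof. exact: sqrtr_ge0. Qed.

Lemma sqr_enorm (R : realType) (d : nat) (x : 'rV[R]_d) :
  enorm x ^+ 2 = \sum_i x ord0 i ^+ 2.
Proof. by rewrite sqr_sqrtr// sumr_ge0// => i _; rewrite sqr_ge0. Qed.

Lemma coord_le_norm (R : realType) (d : nat) (x : 'rV[R]_d) i :
  `|x ord0 i| <= `|x|.
Proof.
rewrite {2}/Num.norm/= mx_normrE.
by apply: (@le_bigmax_cond _ _ _ _ (ord0, i) _ (fun ij => `|x ij.1 ij.2|)).
Qed.

Lemma coord_le_enorm (R : realType) (d : nat) (x : 'rV[R]_d) i :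
  `|x ord0 i| <= enorm x.
Proof.
rewrite -(@ler_pXn2r _ 2)// ?nnegrE ?enorm_ge0// sqr_enorm real_normK ?num_real//.
by rewrite (bigD1 i)//= lerDl sumr_ge0// => j _; rewrite sqr_ge0.
Qed.

Lemma norm_le_enorm (R : realType) (d : nat) (x : 'rV[R]_d) : `|x| <= enorm x.
Proof.
rewrite {1}/Num.norm/= mx_normrE; apply: bigmax_le => [|[i j] _/=].
  exact: enorm_ge0.
by rewrite ord1 coord_le_enorm.
Qed.

Lemma enorm_le_norm (R : realType) (d : nat) (x : 'rV[R]_d) :
  enorm x <= (d%:R + 1) * `|x|.
Proof.
have d1 : 0 <= (d%:R + 1 : R) by rewrite addr_ge0.
rewrite -(@ler_pXn2r _ 2)// ?nnegrE ?enorm_ge0 ?mulr_ge0// sqr_enorm.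
apply: (@le_trans _ _ (\sum_(i < d) `|x| ^+ 2)).
  apply: ler_sum => i _; rewrite -real_normK ?num_real//.
  by rewrite lerXn2r// ?nnegrE// coord_le_norm.
rewrite sumr_const card_ord -[leLHS]mulr_natl exprMn ler_wpM2r ?sqr_ge0//.
by have : 0 <= (d%:R : R) by []; nra.
Qed.

(* Compactness of the unit sphere. *)
Lemma norm_ge_enorm (R : realType) (d : nat) (N : 'rV[R]_d -> R) :
  N 0 = 0 -> (forall x y, N (x + y) <= N x + N y) ->
  (forall a x, N (a *: x) = `|a| * N x) -> (forall x, x != 0 -> 0 < N x) ->
  exists2 c, 0 < c & forall x, c * enorm x <= N x.
Proof.
move=> N0 ND NZ Npos; have cN := norm_continuous_of_seminorm N0 ND NZ.
have [c c0 cP] : exists2 c, 0 < c & forall x : 'rV[R]_d, c * `|x| <= N x.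
  pose S := [set x : 'rV[R]_d | `|x| = 1].
  (* The sphere is empty when [d = 0]; then every vector is 0 and any constant works. *)
  have [S0|/set0P S0] := eqVneq S set0.
    exists 1 => // x; have [->|x0] := eqVneq x 0; first by rewrite normr0 mulr0 N0.
    exfalso; have : S (`|x|^-1 *: x); last by rewrite S0.
    by rewrite /S/= normrZ normfV normr_id mulVf// normr_eq0.
  have cS : compact S.
    apply: bounded_closed_compact; last first.
      have -> : S = (fun x => `|x|) @^-1` [set 1] by [].
      by apply: closed_comp => [x _|]; [exact: norm_continuous|exact: closed_eq].
    by exists 1; split => // t t1 x /= ->; exact: ltW.
  have [y yS ymin] := compact_EVT_min S0 cS (continuous_subspaceT cN).
  have y0 : y != 0.
    by move: yS; rewrite inE /S/= => h; rewrite -normr_eq0 h oner_eq0.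
  exists (N y); first exact: Npos.
  move=> x; have [->|x0] := eqVneq x 0; first by rewrite normr0 mulr0 N0.
  have xp : 0 < `|x| by rewrite normr_gt0.
  have : N y <= N (`|x|^-1 *: x).
    by apply: ymin; rewrite inE/S/= normrZ normfV normr_id mulVf// normr_eq0.
  by rewrite NZ normfV normr_id mulrC ler_pdivlMr// mulrC.
have d1 : 0 < (d%:R + 1 : R) by rewrite ltr_wpDl.
exists (c / (d%:R + 1)) => [|x]; first exact: divr_gt0.
apply: le_trans (cP x); rewrite -mulrA ler_pM2l// mulrC ler_pdivrMr// mulrC.
exact: enorm_le_norm.
Qed.

(** * Homogeneous action densities: factorisation, extension to zero density, recession function *)

Section action_density.
Context (R : realType) (d : nat) (phi : R -> 'rV[R]_d -> R) (p theta : R).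
Hypotheses (p1 : 1 < p) (adm : admissible p phi) (theta1 : 1 < theta)
  (thetap : theta <= p) (hom : homogeneous theta phi).

Let p0 : 0 < p. Proof. exact: lt_trans p1. Qed.

Lemma density_ge0 rho w : 0 < rho -> 0 <= phi rho w.
Proof. by case: adm => h _ _ _; exact: h. Qed.

Lemma density_scale rho a w : 0 < rho -> phi rho (a *: w) = `|a| `^ p * phi rho w.
Proof. by case: adm => _ _ h _; exact: h. Qed.

Lemma density_w0 rho : 0 < rho -> phi rho 0 = 0.
Proof.
move=> rho0; rewrite -(scale0r (0 : 'rV[R]_d)) density_scale// normr0 powR0 ?mul0r//.
exact: lt0r_neq0.
Qed.

(** Write w = rho (w / rho): homogeneity in the pair extracts rho^theta, and p-homogeneity in the
    flux alone gives back rho^(-p). *)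
Lemma density_factor rho w : 0 < rho -> phi rho w = rho `^ (theta - p) * phi 1 w.
Proof.
move=> rho0; have e : w = rho *: (rho^-1 *: w).
  by rewrite scalerA divff ?lt0r_neq0// scale1r.
rewrite {1}e -{1}(mulr1 rho) hom// density_scale//.
rewrite ger0_norm ?invr_ge0 ?ltW// mulrA; congr (_ * _).
rewrite powRD; last by rewrite lt0r_neq0 ?implybT.
by rewrite powRN -powR_inv1 ?powR_ge0// -powR_inv1 ?ltW// -!powRrM mulrC mulN1r mulrN1 mulrC.
Qed.

(** Admissibility gives positivity at one density [rho0] only; the factorisation carries it over to
    density 1. *)
Lemma density1_gt0 w : w != 0 -> 0 < phi 1 w.
Proof.
move=> w0; case: adm => _ _ _ [rho0 rho0_gt0 /(_ _ w0)].
by rewrite density_factor// pmulr_rgt0// powR_gt0.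
Qed.

(** After factorisation this is the sign of the exponent theta - p. *)
Lemma density_nonincreasing r s w : 0 < r -> r <= s -> phi s w <= phi r w.
Proof.
move=> r0 rs; have s0 : 0 < s by exact: lt_le_trans rs.
rewrite !(density_factor _ r0) (density_factor _ s0) ler_wpM2r ?density_ge0//.
rewrite -(opprB p theta) !powRN lef_pV2 ?posrE ?powR_gt0//.
by apply: ge0_ler_powR; rewrite ?nnegrE ?subr_ge0// ltW.
Qed.

(* By convexity and p-homogeneity, phi(1, w)^(1/p) is a norm. *)
Lemma density_lower_bound : exists2 c, 0 < c &
  forall rho w, 0 < rho -> c * (rho `^ (theta - p) * enorm w `^ p) <= phi rho w.
Proof.
pose N w := phi 1 w `^ p^-1.
have pV : p^-1 != 0 by rewrite invr_eq0 lt0r_neq0.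
have Np w : N w `^ p = phi 1 w.
  by rewrite /N -powRrM mulVf ?lt0r_neq0// powRr1// density_ge0.
have N0 : N 0 = 0 by rewrite /N density_w0// powR0.
have NZ a w : N (a *: w) = `|a| * N w.
  rewrite /N density_scale// powRM ?powR_ge0 ?density_ge0//.
  by rewrite -powRrM divff ?lt0r_neq0// powRr1.
have Nge0 w : 0 <= N w by exact: powR_ge0.
have Npos w : w != 0 -> 0 < N w by move=> w0; apply: powR_gt0; exact: density1_gt0.
have N1 w : w != 0 -> phi 1 ((N w)^-1 *: w) = 1.
  move=> w0; rewrite -Np NZ normfV ger0_norm// mulVf ?powR1//.
  by rewrite lt0r_neq0// Npos.
have ND x y : N (x + y) <= N x + N y.
  have [->|x0] := eqVneq x 0; first by rewrite N0 !add0r.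
  have [->|y0] := eqVneq y 0; first by rewrite N0 !addr0.
  have [a0 b0] := (Npos _ x0, Npos _ y0).
  set a := N x in a0 *; set b := N y in b0 *.
  have ab0 : 0 < a + b by exact: addr_gt0.
  case: adm => _ cvx _ _.
  (* Convexity is used at the normalised vectors x / a and y / b, with weights chosen so that their
     convex combination is (x + y) / (a + b). The value there is at most 1, which is the triangle
     inequality after rescaling. *)
  have := cvx 1 1 (a^-1 *: x) (b^-1 *: y) (a / (a + b)) ltr01 ltr01.
  have -> : 1 - a / (a + b) = b / (a + b).
    by field; rewrite lt0r_neq0.
  have l01 : 0 <= a / (a + b) <= 1.
    apply/andP; split; first by rewrite divr_ge0// ltW.
    by rewrite ler_pdivrMr// mul1r lerDl ltW.
  move=> /(_ l01).
  rewrite !N1// !mulr1 -mulrDl divff ?lt0r_neq0//.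
  have -> : (a / (a + b)) *: (a^-1 *: x) + (b / (a + b)) *: (b^-1 *: y) =
     (a + b)^-1 *: (x + y).
    rewrite !scalerA scalerDr; congr (_ *: _ + _ *: _).
      by rewrite mulrC mulrA mulVf ?lt0r_neq0// mul1r.
    by rewrite mulrC mulrA mulVf ?lt0r_neq0// mul1r.
  move=> h; rewrite -[leRHS]mulr1 -ler_pdivrMl//.
  have -> : (a + b)^-1 * N (x + y) = N ((a + b)^-1 *: (x + y)).
    by rewrite NZ normfV gtr0_norm.
  rewrite /N.
  apply: (@le_trans _ _ (1 `^ p^-1)); last by rewrite powR1.
  by apply: ge0_ler_powR; rewrite ?nnegrE ?density_ge0// invr_ge0 ltW.
have [c c0 cN] := norm_ge_enorm N0 ND NZ Npos.
exists (c `^ p) => [|rho w rho0]; first exact: powR_gt0.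
rewrite (density_factor _ rho0) mulrCA ler_wpM2l ?powR_ge0//.
rewrite -powRM ?enorm_ge0 ?(ltW c0)// -Np.
by apply: ge0_ler_powR; rewrite ?nnegrE ?mulr_ge0 ?enorm_ge0 ?(ltW c0) ?(ltW p0).
Qed.

Local Open Scope ereal_scope.

(** At [r = 0] the extension is the right limit of a nonincreasing function, hence a supremum of
    values at positive densities. Comparison with a positive [s] replaces any computation of that
    limit. *)
Lemma phi_ext_ge r s w : (0 <= r)%R -> (0 < s)%R -> (r <= s)%R ->
  (phi s w)%:E <= phi_ext phi r w.
Proof.
move=> r0 s0 rs; rewrite /phi_ext; case: ifPn => r1.
  by rewrite lee_fin density_nonincreasing.
have := @nonincreasing_at_right_cvge _ (fun s => (phi s w)%:E) 0%R +oo%O isT.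
have ni : {in Interval (BRight 0%R) (BInfty R false) &, {homo (fun s0 : R => (phi s0 w)%:E) :
     n m / (n <= m)%R >-> m <= n}}.
  move=> a b; rewrite !in_itv/= !andbT => a0 b0 ab.
  by rewrite lee_fin density_nonincreasing.
move=> /(_ ni) /cvg_lim => ->//.
by apply: ereal_sup_ubound; exists s => //=; rewrite in_itv/= s0.
Qed.

Lemma phi_ext_ge0 r w : (0 <= r)%R -> 0 <= phi_ext phi r w.
Proof.
move=> r0; have r1 : (0 < r + 1)%R by rewrite ltr_wpDl.
apply: (@le_trans _ _ (phi (r + 1)%R w)%:E); first by rewrite lee_fin density_ge0.
by apply: phi_ext_ge => //; rewrite lerDl.
Qed.

Lemma phi_ext_w0 r : (0 <= r)%R -> phi_ext phi r 0%R = 0.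
Proof.
move=> r0; rewrite /phi_ext; case: ifPn => r1; first by rewrite density_w0.
apply: cvg_lim => //; apply: cvg_near_cst.
by near=> s; rewrite density_w0.
Unshelve. all: end_near. Qed.

Lemma phi_inf_w0 r : (0 <= r)%R -> phi_inf phi r 0%R = 0.
Proof.
move=> r0; apply: cvg_lim => //; apply: cvg_near_cst.
near=> l; have l0 : (0 <= l)%R by near: l; exact: nbhs_pinfty_ge.
by rewrite scaler0 phi_ext_w0 ?mule0// mulr_ge0.
Unshelve. all: end_near. Qed.

(** The quotient is at least l^(theta-1) phi(s, w) with s = r + 1, and the exponent is positive.
    Taking r + 1 instead of r covers [r = 0], where the extension has no closed form. *)
Lemma phi_inf_neq0 r w : (0 <= r)%R -> w != 0%R -> phi_inf phi r w = +oo.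
Proof.
move=> r0 w0; apply: cvg_lim => //.
pose s : R := (r + 1)%R.
have s0 : (0 < s)%R by rewrite ltr_wpDl.
have cs : (0 < phi s w)%R.
  by rewrite density_factor// mulr_gt0 ?powR_gt0// density1_gt0.
have t1 : (0 < theta - 1)%R by rewrite subr_gt0.
apply/cvgeyPgey; near=> A; near=> l.
have A0 : (0 < A)%R by near: A; exact: nbhs_pinfty_gt.
have l0 : (0 < l)%R by near: l; exact: nbhs_pinfty_gt.
apply: (@le_trans _ _ ((l^-1)%:E * (phi (l * s)%R (l *: w))%:E)); last first.
  apply: lee_wpmul2l; first by rewrite lee_fin invr_ge0 ltW.
  apply: phi_ext_ge; [by rewrite mulr_ge0// ltW|exact: mulr_gt0|].
  by rewrite ler_pM2l// lerDl.
rewrite hom// -EFinM lee_fin mulrA.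
have -> : (l^-1 * l `^ theta = l `^ (theta - 1))%R.
  by rewrite powRB ?powRr1 ?(ltW l0)// 1?mulrC// lt0r_neq0// implybT.
rewrite -ler_pdivrMr//.
have Ac : (0 <= A / phi s w)%R by rewrite divr_ge0// ltW.
have -> : (A / phi s w = ((A / phi s w) `^ (theta - 1)^-1) `^ (theta - 1))%R.
  by rewrite -powRrM mulVf ?powRr1// lt0r_neq0.
apply: ge0_ler_powR; rewrite ?nnegrE ?powR_ge0 ?(ltW t1) ?(ltW l0)//.
Unshelve. all: end_near. Qed.

End action_density.

(** * Three-term Young inequality for the flux *)

(** Each factor is at most the corresponding power of the sum, and the exponents add up to 1. Strict
    positivity of [a] matters when the sum vanishes, since 0 to the power 0 is 1. *)
Lemma weighted_geometric_le_sum (R : realType) (X Y Z a b c : R) :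
  0 <= X -> 0 <= Y -> 0 <= Z -> 0 < a -> 0 <= b -> 0 <= c -> a + b + c = 1 ->
  X `^ a * (Y `^ b * Z `^ c) <= X + Y + Z.
Proof.
move=> X0 Y0 Z0 a0 b0 c0 abc; set S := X + Y + Z.
have S0 : 0 <= S by rewrite !addr_ge0.
have le x t : 0 <= t -> 0 <= x -> x <= S -> x `^ t <= S `^ t.
  by move=> t0 x0 xS; apply: ge0_ler_powR => //; rewrite nnegrE.
have [S00|Sn0] := eqVneq S 0.
  have X00 : X = 0 by apply/eqP; rewrite eq_le X0 -S00 /S -addrA lerDl addr_ge0.
  by rewrite X00 powR0 ?lt0r_neq0// mul0r.
apply: (@le_trans _ _ (S `^ a * (S `^ b * S `^ c))).
  have [XS YS ZS] : [/\ X <= S, Y <= S & Z <= S] by rewrite /S; split; lra.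
  apply: ler_pM; rewrite ?mulr_ge0 ?powR_ge0 ?le ?(ltW a0)//.
  by apply: ler_pM; rewrite ?powR_ge0 ?le.
by rewrite -!powRD ?Sn0 ?implybT// addrA abc powRr1.
Qed.

Section young.
Context (R : realType) (d : nat) (phi : R -> 'rV[R]_d -> R) (p theta : R).
Hypotheses (p1 : 1 < p) (adm : admissible p phi) (theta1 : 1 < theta)
  (thetap : theta <= p) (hom : homogeneous theta phi).

(** The weighted inequality is applied to X = al c0 rho^(theta-p) |w|^p, Y = be psi rho and Z = ta G
    with exponents 1/p, 1 - theta/p and (theta-1)/p. The powers of rho cancel, and the bound on [K]
    is what the three coefficients contribute to the product. *)
Lemma density_young (c0 K al be ta psi G rho : R) (w : 'rV[R]_d) :
  0 < c0 ->
  (forall rho w, 0 < rho -> c0 * (rho `^ (theta - p) * enorm w `^ p) <= phi rho w) ->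
  0 < al -> 0 < be -> 0 < ta ->
  K <= (al * c0) `^ p^-1 * (be `^ (1 - theta / p) * ta `^ ((theta - 1) / p)) ->
  0 <= psi -> 0 <= G -> 0 < rho ->
  K * (psi `^ (1 - theta / p) * G `^ ((theta - 1) / p)) * enorm w <=
  al * phi rho w + be * (psi * rho) + ta * G.
Proof.
move=> c00 lb al0 be0 ta0 KP psi0 G0 rho0.
have p0 : 0 < p by exact: lt_trans p1.
set b := 1 - theta / p in KP *; set c := (theta - 1) / p in KP *.
have b0 : 0 <= b by rewrite subr_ge0 ler_pdivrMr// mul1r.
have cc0 : 0 <= c by apply: divr_ge0; [rewrite subr_ge0 ltW|rewrite ltW].
have abc : p^-1 + b + c = 1 by rewrite /b/c; field; exact: lt0r_neq0.
have e0 := enorm_ge0 w.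
have r0 : 0 <= c0 * (rho `^ (theta - p) * enorm w `^ p).
  by rewrite !mulr_ge0 ?powR_ge0// ltW.
apply: (@le_trans _ _ (al * c0 * (rho `^ (theta - p) * enorm w `^ p) +
    be * (psi * rho) + ta * G)); last first.
  by rewrite !lerD2r -mulrA ler_wpM2l ?(ltW al0) ?lb.
have ac0 : 0 < al * c0 by exact: mulr_gt0.
have pV0 : 0 < p^-1 by rewrite invr_gt0.
have Y0 : 0 <= be * (psi * rho) by rewrite !mulr_ge0 ?(ltW be0) ?(ltW rho0).
have Z0 : 0 <= ta * G by rewrite mulr_ge0 ?(ltW ta0).
have X0 : 0 <= al * c0 * (rho `^ (theta - p) * enorm w `^ p).
  by rewrite -mulrA mulr_ge0 ?(ltW al0).
move: KP ac0 X0; move: (al * c0) => ac KP ac0 X0.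
apply: le_trans (weighted_geometric_le_sum X0 Y0 Z0 pV0 b0 cc0 abc).
rewrite !powRM ?mulr_ge0 ?powR_ge0 ?(ltW ac0) ?(ltW be0) ?(ltW ta0) ?(ltW rho0)//.
rewrite -!powRrM divff ?lt0r_neq0// powRr1//.
have rr : rho `^ ((theta - p) / p) * rho `^ b = 1.
  rewrite -powRD ?lt0r_neq0 ?implybT//.
  have -> : (theta - p) / p + b = 0 by rewrite /b; field; exact: lt0r_neq0.
  exact: powRr0.
set u := psi `^ b; set v := G `^ c.
apply: (@le_trans _ _ (ac `^ p^-1 * (be `^ b * ta `^ c) * (u * v) * enorm w)).
  by rewrite ler_wpM2r// ler_wpM2r// mulr_ge0 ?powR_ge0.
set A := ac `^ _; set B := be `^ b; set C := ta `^ c.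
rewrite le_eqVlt; apply/orP; left; apply/eqP.
transitivity (A * (B * C) * (u * v) * enorm w * (rho `^ ((theta - p) / p) * rho `^ b)).
  by rewrite rr mulr1.
by ring.
Qed.

(** Zero density is reached by perturbation: the inequality at [rho + s] involves a smaller action,
    because the density is nonincreasing, and an error be psi s. *)
Lemma phi_ext_young (c0 K al be ta psi G rho : R) (w : 'rV[R]_d) :
  0 < c0 ->
  (forall rho w, 0 < rho -> c0 * (rho `^ (theta - p) * enorm w `^ p) <= phi rho w) ->
  0 < al -> 0 < be -> 0 < ta ->
  K <= (al * c0) `^ p^-1 * (be `^ (1 - theta / p) * ta `^ ((theta - 1) / p)) ->
  0 <= psi -> 0 <= G -> 0 <= rho ->
  ((K * (psi `^ (1 - theta / p) * G `^ ((theta - 1) / p)) * enorm w)%:E <=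
  al%:E * phi_ext phi rho w + (be * (psi * rho) + ta * G)%:E)%E.
Proof.
move=> c00 lb al0 be0 ta0 KP psi0 G0 rho0; apply/lee_addgt0Pr => e e0.
have bp : 0 < be * psi + 1 by rewrite ltr_wpDl// mulr_ge0// ltW.
(* This makes the error be psi s at most [e]; the 1 keeps the denominator positive when psi = 0. *)
pose s := e / (be * psi + 1); have s0 : 0 < s by rewrite divr_gt0.
have rs0 : 0 < rho + s by rewrite ltr_wpDl.
have h := density_young w c00 lb al0 be0 ta0 KP psi0 G0 rs0.
have h1 : ((phi (rho + s) w)%:E <= phi_ext phi rho w)%E.
  by apply: (phi_ext_ge adm thetap hom) => //; rewrite lerDl ltW.
apply: (@le_trans _ _ (al%:E * (phi (rho + s) w)%:E + (be * (psi * rho) + ta * G)%:E + e%:E)%E).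
  rewrite -EFinM -!EFinD lee_fin; apply: le_trans h _.
  have : be * psi * s <= e.
    rewrite /s mulrA ler_pdivrMr// mulrDr mulr1 mulrC lerDl ltW//.
  have -> : be * (psi * (rho + s)) = be * (psi * rho) + be * psi * s by ring.
  lra.
rewrite leeD2r// leeD2r// lee_wpmul2l// lee_fin ltW//.
Qed.

End young.

Import HBNNSimple.

(** * From identities on bounded Borel sets to integrals of test functions *)

Section bounded_support.
Context (R : realType) (d : nat).
Implicit Types (f v : Rd R d -> R) (r : R).

Lemma continuous_measurable_Rd (f : 'rV[R]_d -> R) :
  continuous f -> measurable_fun setT (f : Rd R d -> R).
Proof.
move=> /continuousP cf.
apply: (measurability _ (RGenOpens.measurableE R)) => _ [_ [a [b ->] <-]].
by rewrite setTI; apply: sub_sigma_algebra; apply: cf; exact: interval_open.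
Qed.

Lemma continuous_sqr_enorm : continuous (fun x : 'rV[R]_d => enorm x ^+ 2).
Proof.
have -> : (fun x : 'rV[R]_d => enorm x ^+ 2) = fun x => \sum_(i < d) x ord0 i ^+ 2.
  by apply/funext => x; rewrite sqr_enorm.
apply: (@continuous_big R 'I_d _ _ xpredT (@add_continuous R) 'rV[R]_d) => i _ x.
by apply: continuousM; exact: coord_continuous.
Qed.

Lemma continuous_enorm : continuous (@enorm R d).
Proof.
have -> : @enorm R d = fun x => Num.sqrt (enorm x ^+ 2).
  by apply/funext => x; rewrite sqrtr_sqr ger0_norm// enorm_ge0.
by move=> x; apply: continuous_comp; [exact: continuous_sqr_enorm|exact: sqrt_continuous].
Qed.

Lemma measurable_eball r : measurable (eball 0 r : set (Rd R d)).
Proof.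
have -> : eball 0 r = [set: Rd R d] `&` (@enorm R d) @^-1` `]-oo, r[%classic.
  by apply/seteqP; split => x; rewrite /eball/= in_itv/= subr0 => // -[].
by apply: (continuous_measurable_Rd continuous_enorm).
Qed.

Lemma eball0E r (x : 'rV[R]_d) : eball 0 r x <-> enorm x < r.
Proof. by rewrite /eball/= subr0. Qed.

(** Test class for signed densities that are only locally integrable: the product with such a
    density is integrable on the whole space, so no undefined difference of infinities arises. *)
Definition bounded_supp r f := [/\ measurable_fun setT f,
  exists M, forall x, `|f x| <= M & forall x, ~ eball 0 r x -> f x = 0].

Lemma bounded_supp0 r : bounded_supp r (cst 0).
Proof. by split => //; exists 0 => x; rewrite normr0. Qed.

Lemma bounded_suppZD r a f g : bounded_supp r f -> bounded_supp r g ->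
  bounded_supp r (fun x => a * f x + g x).
Proof.
move=> [mf [M fM] f0] [mg [M' gM'] g0]; split.
- by apply: measurable_funD => //; exact: measurable_funM.
- exists (`|a| * M + M') => x; apply: le_trans (ler_normD _ _) _.
  by rewrite normrM lerD// ler_wpM2l.
- by move=> x xr; rewrite f0// g0// mulr0 addr0.
Qed.

Lemma bounded_supp_indic r (A : set (Rd R d)) : measurable A ->
  A `<=` eball 0 r -> bounded_supp r (\1_A).
Proof.
move=> mA Ar; split; first exact: measurable_indic.
- by exists 1 => x; rewrite indicE; case: (_ \in _); rewrite ?normr1 ?normr0.
- by move=> x xr; rewrite indicE memNset// => /Ar.
Qed.

(** A functional monotone class argument. Simple approximations of a nonnegative function lie below
    it, so they inherit its bound and vanish outside the ball; positive and negative parts then give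
    the general case. *)
Lemma bounded_supp_ind r (P : (Rd R d -> R) -> Prop) :
  P (cst 0) ->
  (forall A, measurable A -> A `<=` eball 0 r -> P (\1_A)) ->
  (forall a f g, bounded_supp r f -> bounded_supp r g -> P f -> P g ->
     P (fun x => a * f x + g x)) ->
  (forall (f_ : nat -> Rd R d -> R) f M, (forall n, bounded_supp r (f_ n)) ->
     bounded_supp r f -> (forall n x, `|f_ n x| <= M) ->
     (forall x, f_ n x @[n --> \oo] --> f x) -> (forall n, P (f_ n)) -> P f) ->
  forall f, bounded_supp r f -> P f.
Proof.
move=> P0 P1 PD Plim.
have Pge0 f : (forall x, 0 <= f x) -> bounded_supp r f -> P f.
  move=> f0 bf; have [mf [M fM] fr] := bf.
  have mf' : measurable_fun setT (EFin \o f) by exact: measurableT_comp.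
  pose g := nnsfun_approx measurableT mf'.
  have gf n x : g n x <= f x.
    by rewrite -lee_fin /g nnsfun_approxE le_approx// => t _; rewrite lee_fin.
  have g0 n x : ~ eball 0 r x -> g n x = 0.
    by move=> /fr xr; apply/eqP; rewrite eq_le fun_ge0 andbT -xr gf.
  have gsum n : bounded_supp r (g n) /\ P (g n).
    pose s : seq R := finmap.enum_fset (fset_set (range (g n))).
    have gE : (g n : _ -> _) = fun x => \sum_(y <- s) y * \1_((g n) @^-1` [set y]) x.
      by apply/funext => x; rewrite {1}(fimfunE (g n)) fsbig_finite.
    rewrite gE; elim: s {gE} => [|y t [IHb IHP]].
      have -> : (fun x : Rd R d => \sum_(y <- [::]) y * \1_((g n) @^-1` [set y]) x) = cst 0.
        by apply/funext => x; rewrite big_nil.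
      by split => //; exact: bounded_supp0.
    (* The level set of the value 0 may leave the ball, so this term is dropped; every other level
       set lies inside. *)
    have [->|y0] := eqVneq y 0.
      rewrite (_ : (fun _ => _) = fun x => \sum_(y <- t) y * \1_((g n) @^-1` [set y]) x)//.
      by apply/funext => x; rewrite big_cons mul0r add0r.
    rewrite (_ : (fun _ => _) = fun x => y * \1_((g n) @^-1` [set y]) x +
       \sum_(y <- t) y * \1_((g n) @^-1` [set y]) x); last first.
      by apply/funext => x; rewrite big_cons.
    have mA : measurable ((g n) @^-1` [set y]) by exact: measurable_sfunP.
    have Ar : (g n) @^-1` [set y] `<=` eball 0 r.
      move=> x /= gy; apply: contrapT => /(g0 n); rewrite gy => y00.
      by rewrite y00 eqxx in y0.
    have bA := bounded_supp_indic mA Ar.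
    by split; [exact: bounded_suppZD|apply: PD => //; exact: P1].
  apply: (Plim (fun n => g n : Rd R d -> R) f M) => //.
  - by move=> n; case: (gsum n).
  - move=> n x; rewrite ger0_norm//; apply: le_trans (gf _ _) _.
    by apply: le_trans (fM x); exact: ler_norm.
  - move=> x; have := @cvg_nnsfun_approx _ _ _ _ measurableT _ mf' (fun x _ => f0 x) x I.
    by move=> /fine_cvgP[].
  - by move=> n; case: (gsum n).
move=> f [mf [M fM] fr].
have bp : bounded_supp r (fun x => Num.max (f x) 0).
  split; first exact: measurable_maxr.
  - exists M => x; apply: le_trans (fM x).
    by rewrite ger0_norm ?le_max ?lexx ?orbT// ge_max ler_norm/=.
  - by move=> x xr; rewrite fr// maxxx.
have bn : bounded_supp r (fun x => Num.max (- f x) 0).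
  split; first by apply: measurable_maxr => //; exact: measurableT_comp.
  - exists M => x; apply: le_trans (fM x).
    by rewrite ger0_norm ?le_max ?lexx ?orbT// ge_max -normrN ler_norm/=.
  - by move=> x xr; rewrite fr// oppr0 maxxx.
have -> : f = fun x => (-1) * Num.max (- f x) 0 + Num.max (f x) 0.
  apply/funext => x; rewrite mulN1r.
  by have [fx|fx] := leP (f x) 0; [rewrite max_l ?opprK ?addr0 ?oppr_ge0|
    rewrite max_r ?oppr0 ?add0r// oppr_le0 ltW].
by apply: PD => //; apply: Pge0 => // x; rewrite le_max lexx orbT.
Qed.

Local Open Scope ereal_scope.

Lemma bounded_supp_integrable (m : {measure set (Rd R d) -> \bar R}) r f v :
  bounded_supp r f -> m.-integrable (eball 0%R r) (EFin \o v) ->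
  m.-integrable setT (fun x => (f x * v x)%:E).
Proof.
move=> [mf [M fM] f0] iv.
have iv' : m.-integrable setT ((EFin \o v) \_ (eball 0%R r)).
  exact: (iffLR (integrable_mkcond (EFin \o v) (measurable_eball r)) iv).
have -> : (fun x => (f x * v x)%:E) = (EFin \o f) \* ((EFin \o v) \_ (eball 0%R r)).
  apply/funext => x /=; rewrite patchE; case: ifPn => [_//|].
  by rewrite notin_setE => /f0 ->; rewrite mul0r mule0.
apply: integrableMr => //; exists M.
split; first exact: num_real.
by move=> N MN x _ /=; apply: le_trans (fM x) (ltW MN).
Qed.

End bounded_support.

Section bounded_support_integral.
Context (R : realType) (d : nat).
Implicit Types (f v : Rd R d -> R) (r : R).
Local Open Scope ereal_scope.

Lemma bounded_supp_cvg (m : {measure set (Rd R d) -> \bar R}) r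
    (f_ : nat -> Rd R d -> R) f v M :
  (forall n, bounded_supp r (f_ n)) -> bounded_supp r f ->
  (forall n x, `|f_ n x| <= M)%R -> (forall x, f_ n x @[n --> \oo] --> f x) ->
  m.-integrable (eball 0%R r) (EFin \o v) ->
  \int[m]_x (f_ n x * v x)%:E @[n --> \oo] --> \int[m]_x (f x * v x)%:E.
Proof.
move=> bf_ bf fM fl iv.
pose B : set (Rd R d) := eball 0%R r.
have iv' : m.-integrable setT ((EFin \o v) \_ B).
  exact: (iffLR (integrable_mkcond (EFin \o v) (measurable_eball r)) iv).
have [] // := @dominated_convergence _ _ _ m setT measurableT
   (fun n x => (f_ n x * v x)%:E) (fun x => (f x * v x)%:E)
   (fun x => M%:E * `|((EFin \o v) \_ B) x|).
- by move=> n; have /integrableP[] := bounded_supp_integrable (bf_ n) iv.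
- by have /integrableP[] := bounded_supp_integrable bf iv.
- apply: aeW => x _; apply: cvg_EFin; first by near=> n.
  by apply: cvgM => //; exact: cvg_cst.
- by apply: integrableZl => //; exact: integrable_abse.
- apply: aeW => x n _; rewrite patchE; case: ifPn => [_ /=|].
    by rewrite lee_fin normrM ler_wpM2r.
  rewrite notin_setE => xB; have [_ _ ->//] := bf_ n.
  by rewrite mul0r !abse0 mule0.
Unshelve. all: end_near. Qed.

Lemma integral_indicM (m : {measure set (Rd R d) -> \bar R}) (A : set (Rd R d)) v :
  \int[m]_x (\1_A x * v x)%:E = \int[m]_(x in A) (v x)%:E.
Proof.
rewrite [RHS]integral_mkcond; apply: eq_integral => x _.
by rewrite patchE indicE; case: ifPn => _; rewrite ?mul1r ?mul0r.
Qed.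

Lemma bounded_supp_integralZD (m : {measure set (Rd R d) -> \bar R}) r a f g v :
  bounded_supp r f -> bounded_supp r g ->
  m.-integrable (eball 0%R r) (EFin \o v) ->
  \int[m]_x ((a * f x + g x) * v x)%:E =
  a%:E * \int[m]_x (f x * v x)%:E + \int[m]_x (g x * v x)%:E.
Proof.
move=> bf bg iv.
have If := bounded_supp_integrable bf iv; have Ig := bounded_supp_integrable bg iv.
rewrite -integralZl// -integralD//; last exact: integrableZl.
by apply: eq_integral => x _; rewrite mulrDl -mulrA EFinD EFinM.
Qed.

(** Needed because the decomposition of the vector measure is given set by set, whereas the
    estimates test it against gradients. *)
Lemma bounded_supp_integral_eq (m1 m2 : {measure set (Rd R d) -> \bar R}) r v1 v2 :
  m1.-integrable (eball 0%R r) (EFin \o v1) ->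
  m2.-integrable (eball 0%R r) (EFin \o v2) ->
  (forall A, measurable A -> A `<=` eball 0%R r ->
     \int[m1]_(x in A) (v1 x)%:E = \int[m2]_(x in A) (v2 x)%:E) ->
  forall f, bounded_supp r f ->
  \int[m1]_x (f x * v1 x)%:E = \int[m2]_x (f x * v2 x)%:E.
Proof.
move=> i1 i2 eqA; apply: bounded_supp_ind.
- by rewrite !integral0_eq// => x _; rewrite mul0r.
- by move=> A mA Ar; rewrite !integral_indicM eqA.
- by move=> a f g bf bg IHf IHg; rewrite !(@bounded_supp_integralZD _ r)// IHf IHg.
- move=> f_ f M bf_ bf fM fl IH.
  have h1 := bounded_supp_cvg bf_ bf fM fl i1.
  have h2 := bounded_supp_cvg bf_ bf fM fl i2.
  have e : (fun n => \int[m1]_x (f_ n x * v1 x)%:E) =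
      (fun n => \int[m2]_x (f_ n x * v2 x)%:E) by apply/funext.
  by rewrite -(cvg_lim _ h1)// -(cvg_lim _ h2)// e.
Qed.

(** The Borel dependence on time in [CE] is likewise stated for sets; here it passes to fixed test
    functions. *)
Lemma bounded_supp_integral_measurable (m : R -> {measure set (Rd R d) -> \bar R})
    (v : R -> Rd R d -> R) (D : set R) r :
  measurable D ->
  (forall t, D t -> (m t).-integrable (eball 0%R r) (EFin \o v t)) ->
  (forall A, measurable A -> A `<=` eball 0%R r ->
     measurable_fun D (fun t => \int[m t]_(x in A) (v t x)%:E)) ->
  forall f, bounded_supp r f ->
  measurable_fun D (fun t => \int[m t]_x (f x * v t x)%:E).
Proof.
move=> mD iv mA; apply: bounded_supp_ind.
- apply: (eq_measurable_fun (cst 0)) => //= t _.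
  by rewrite integral0_eq// => x _; rewrite mul0r.
- move=> A mA' Ar; apply: (eq_measurable_fun (fun t => \int[m t]_(x in A) (v t x)%:E)).
    by move=> t _; rewrite integral_indicM.
  exact: mA.
- move=> a f g bf bg IHf IHg.
  apply: (eq_measurable_fun (fun t => a%:E * \int[m t]_x (f x * v t x)%:E +
     \int[m t]_x (g x * v t x)%:E)).
    by move=> t /set_mem Dt; rewrite (@bounded_supp_integralZD _ r)//; exact: iv.
  apply: emeasurable_funD => //; exact: measurable_funeM.
- move=> f_ f M bf_ bf fM fl IH.
  apply: (emeasurable_fun_cvg (fun n t => \int[m t]_x (f_ n x * v t x)%:E)) => //.
  by move=> t Dt; apply: bounded_supp_cvg; eauto.
Qed.

(** Dropping the singular part of mu leaves an inequality between measures. It holds for simple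
    functions by linearity and for [psi] by monotone convergence, with infinite values allowed. *)
Lemma integral_density_le (gamma mu : {measure set (Rd R d) -> \bar R})
    (rho psi : Rd R d -> R) :
  measurable_fun setT rho -> (forall x, 0 <= rho x)%R ->
  measurable_fun setT psi -> (forall x, 0 <= psi x)%R ->
  (forall A, measurable A -> \int[gamma]_(x in A) (rho x)%:E <= mu A) ->
  \int[gamma]_x (psi x * rho x)%:E <= \int[mu]_x (psi x)%:E.
Proof.
move=> mrho rho0 mpsi psi0 le.
have mpsi' : measurable_fun setT (EFin \o psi) by exact: measurableT_comp.
pose g := nnsfun_approx measurableT mpsi'.
have gpsi n x : (g n x <= psi x)%R.
  by rewrite -lee_fin /g nnsfun_approxE le_approx// => t _; rewrite lee_fin.
have mg n : measurable_fun setT (g n) by [].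
have step n : \int[gamma]_x (g n x * rho x)%:E <= \int[mu]_x (g n x)%:E.
  pose s : seq R := finmap.enum_fset (fset_set (range (g n))).
  pose A y : set (Rd R d) := (g n) @^-1` [set y].
  have mA y : measurable (A y) by exact: measurable_sfunP.
  have gE : (g n : _ -> _) = fun x => (\sum_(i < size s) s`_i * \1_(A s`_i) x)%R.
    by apply/funext => x; rewrite {1}(fimfunEord (g n)).
  have s0 i : (i < size s)%N -> (0 <= s`_i)%R.
    move=> /(mem_nth 0%R); rewrite /s in_fset_set// inE => -[x _ <-].
    exact: fun_ge0.
  have ind0 y x : (0 <= \1_(A y) x :> R)%R by rewrite indicE.
  rewrite gE.
  under eq_integral do rewrite mulr_suml -sumEFin.
  under [leRHS]eq_integral do rewrite -sumEFin.
  rewrite ge0_integral_sum//; last 2 first.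
  - by move=> i; apply/measurable_EFinP; do 2 apply: measurable_funM => //.
  - by move=> i x _; rewrite lee_fin !mulr_ge0 ?s0.
  rewrite ge0_integral_sum//; last 2 first.
  - by move=> i; apply/measurable_EFinP; apply: measurable_funM => //.
  - by move=> i x _; rewrite lee_fin mulr_ge0 ?s0.
  apply: lee_sum => i _.
  under eq_integral do rewrite -mulrA EFinM.
  under [leRHS]eq_integral do rewrite EFinM.
  have -> : \int[gamma]_x ((s`_i)%:E * (\1_(A s`_i) x * rho x)%:E) =
      (s`_i)%:E * \int[gamma]_x (\1_(A s`_i) x * rho x)%:E.
    apply: ge0_integralZl_EFin => //; last exact: s0.
    - by move=> x _; rewrite lee_fin mulr_ge0.
    - by apply/measurable_EFinP; exact: measurable_funM.
  have mi : measurable_fun setT (fun x => (\1_(A s`_i) x : R)%:E).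
    by apply/measurable_EFinP; exact: measurable_indic.
  have si0 := s0 i (ltn_ord i).
  rewrite (ge0_integralZl_EFin _ _ _ mi si0)//.
  apply: lee_wpmul2l; first by rewrite lee_fin s0.
  by rewrite integral_indicM integral_indic// setIT le.
have cvg1 : \int[gamma]_x (g n x * rho x)%:E @[n --> \oo] --> \int[gamma]_x (psi x * rho x)%:E.
  have := @cvg_monotone_convergence _ _ _ gamma setT measurableT
    (fun n x => (g n x * rho x)%:E).
  have -> : (fun x0 : Rd R d => limn (fun n => (g n x0 * rho x0)%:E)) =
     (fun x => (psi x * rho x)%:E).
    apply/funext => x; apply: cvg_lim => //; apply: cvg_EFin; first by near=> n.
    apply: cvgM; last exact: cvg_cst.
    have := @cvg_nnsfun_approx _ _ _ _ measurableT _ mpsi' (fun x _ => psi0 x) x I.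
    by move=> /fine_cvgP[].
  apply.
  - by move=> n; apply/measurable_EFinP; exact: measurable_funM.
  - by move=> n x _; rewrite lee_fin mulr_ge0.
  - move=> x _ a b ab; rewrite lee_fin ler_wpM2r//.
    by have /(_ _ _ ab)/lefP := nd_nnsfun_approx measurableT mpsi'; exact.
apply: (cvge_to_le cvg1); near=> n; apply: le_trans (step n) _.
apply: ge0_le_integral => //; first by move=> x _; rewrite lee_fin.
- exact/measurable_EFinP.
- by move=> x _; rewrite lee_fin.
Unshelve. all: end_near. Qed.

End bounded_support_integral.

(* No measurability is needed: the integral of a nonnegative function is a supremum over the
   simple functions below it. This matters for the action density and for t |-> Phi. *)
Lemma ge0_le_lower_integral (dd : measure_display) (T : measurableType dd) (R : realType)
  (m : {measure set T -> \bar R}) (D : set T) (f g : T -> \bar R) :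
  (forall x, D x -> 0 <= f x)%E -> (forall x, D x -> f x <= g x)%E ->
  (\int[m]_(x in D) f x <= \int[m]_(x in D) g x)%E.
Proof.
move=> f0 fg.
rewrite !ge0_integralE//; last by move=> x Dx; apply: le_trans (fg _ Dx); exact: f0.
apply: le_ereal_sup => _ [h hf <-]; exists h => // x; apply: le_trans (hf x) _.
by rewrite !patchE; case: ifPn => // /set_mem; exact: fg.
Qed.

(** * The flux at a fixed time, controlled by the action of one decomposition *)

Section flux.
Context (R : realType) (d : nat) (phi : R -> 'rV[R]_d -> R) (p theta : R).
Hypotheses (p1 : 1 < p) (adm : admissible p phi) (theta1 : 1 < theta)
  (thetap : theta <= p) (hom : homogeneous theta phi).
Context (gamma mu sig : {measure set (Rd R d) -> \bar R}) (u : 'rV[R]_d -> 'rV[R]_d)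
  (rho : Rd R d -> R) (w : Rd R d -> 'rV[R]_d) (s : {measure set (Rd R d) -> \bar R})
  (rhop : Rd R d -> R) (wp : Rd R d -> 'rV[R]_d).
Hypothesis dec : lebdec gamma mu sig u rho w s rhop wp.
Local Open Scope ereal_scope.

Lemma measurable_enorm (v : Rd R d -> 'rV[R]_d) :
  (forall i, measurable_fun setT (fun x => v x ord0 i)) ->
  measurable_fun setT (fun x => enorm (v x)).
Proof.
move=> mv.
have -> : (fun x : Rd R d => enorm (v x)) =
    Num.sqrt \o (fun x => \sum_(i < d) (v x ord0 i) ^+ 2)%R by [].
apply: measurableT_comp; first by apply: continuous_measurable_fun; exact: sqrt_continuous.
by apply: measurable_sum => i; exact: measurable_funX.
Qed.

Lemma enorm_eq0 (x : 'rV[R]_d) : (enorm x == 0%R) = (x == 0%R).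
Proof.
apply/eqP/eqP => [x0|->]; last first.
  by rewrite /enorm big1 ?sqrtr0// => i _; rewrite mxE expr0n.
by apply/rowP => i; apply/eqP; rewrite mxE -normr_le0 -x0 coord_le_enorm.
Qed.

Let Z : set (Rd R d) := [set x | wp x != 0%R].

Let mZ : measurable Z.
Proof.
case: dec => -[_ [_ mwp] _ _ _] _.
have -> : Z = setT `&` (fun x => enorm (wp x)) @^-1` (~` [set 0%R]).
  rewrite setTI; apply/seteqP; split => x; rewrite /Z/=.
    by move=> h /eqP; rewrite enorm_eq0 (negbTE h).
  by move=> h; apply/negP; rewrite -enorm_eq0 => /eqP.
by apply: (measurable_enorm mwp) => //; apply: measurableC.
Qed.

(* By superlinearity of phi the recession part of the action is infinite unless the
   singular part of the flux vanishes. *)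
Lemma integral_phi_inf : \int[s]_x phi_inf phi (rhop x) (wp x) = +oo * s Z.
Proof.
rewrite -integral_cst// [RHS]integral_mkcond; apply: eq_integral => x _.
case: dec => -[_ _ [_ rhop0] _ _] _.
rewrite patchE; case: ifPn => [/set_mem xZ|].
  by rewrite (phi_inf_neq0 adm theta1 thetap hom).
rewrite notin_setE => /negP; rewrite negbK => /eqP ->.
by rewrite (phi_inf_w0 p1 adm).
Qed.

Lemma singular_flux0 (A : set (Rd R d)) i : measurable A -> s Z = 0 ->
  \int[s]_(x in A) (wp x ord0 i)%:E = 0.
Proof.
move=> mA sZ; case: dec => -[_ [_ mwp] _ _ _] _.
have mi : measurable_fun A (fun x => (wp x ord0 i)%:E).
  by apply: measurable_funTS; apply/measurable_EFinP.
rewrite (ae_eq_integral (cst 0))//; first by rewrite integral0.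
exists Z; split => // x /= h; apply: contrapT => xZ; apply: h => _.
by move/negP: xZ; rewrite negbK => /eqP ->; rewrite mxE.
Qed.

Lemma flux_integral_eq r (f : Rd R d -> R) i : s Z = 0 ->
  sig.-integrable (eball 0%R r) (fun x => (u x ord0 i)%:E) ->
  bounded_supp r f ->
  \int[sig]_x (f x * u x ord0 i)%:E = \int[gamma]_x (f x * w x ord0 i)%:E.
Proof.
move=> sZ iu; case: (dec) => -[_ [mw _] _ _ [iw _]] [_ _ eqA].
apply: (@bounded_supp_integral_eq R d sig gamma r (fun x => u x ord0 i)
    (fun x => w x ord0 i)) => //.
  apply: le_integrable (iw r); first exact: measurable_eball.
    by apply: measurable_funTS; apply/measurable_EFinP.
  by move=> x _ /=; rewrite lee_fin (ger0_norm (enorm_ge0 _)) coord_le_enorm.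
move=> A mA Ar; rewrite eqA ?singular_flux0 ?adde0//.
by exists r.
Qed.

(** The pointwise Young inequality is integrated against gamma. Testing coordinate by coordinate
    costs the factor d in the condition on [K]. *)
Lemma flux_bound (c0 K al be ta r : R) (f : 'I_d -> Rd R d -> R) (psi G : Rd R d -> R) :
  (0 < c0)%R ->
  (forall rho w, 0 < rho -> c0 * (rho `^ (theta - p) * enorm w `^ p) <= phi rho w)%R ->
  (0 < al)%R -> (0 < be)%R -> (0 < ta)%R ->
  (d%:R * K <= (al * c0) `^ p^-1 * (be `^ (1 - theta / p) * ta `^ ((theta - 1) / p)))%R ->
  measurable_fun setT psi -> (forall x, 0 <= psi x)%R ->
  measurable_fun setT G -> (forall x, 0 <= G x)%R ->
  (forall i, bounded_supp r (f i)) ->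
  (forall i, sig.-integrable (eball 0%R r) (fun x => (u x ord0 i)%:E)) ->
  (forall i x, `|f i x| <= K * (psi x `^ (1 - theta / p) * G x `^ ((theta - 1) / p)))%R ->
  `| \sum_(i < d) \int[sig]_x (f i x * u x ord0 i)%:E | <=
  al%:E * (\int[gamma]_x phi_ext phi (rho x) (w x) + \int[s]_x phi_inf phi (rhop x) (wp x))
  + be%:E * \int[mu]_x (psi x)%:E + ta%:E * \int[gamma]_x (G x)%:E.
Proof.
move=> c00 lb al0 be0 ta0 KP mpsi psi0 mG G0 bf iu fK.
case: (dec) => -[[mrho _] [mw _] [rho0 rhop0] _ [iw _]] [_ muA _].
have v1_ge0 : 0 <= \int[gamma]_x phi_ext phi (rho x) (w x).
  by apply: integral_ge0 => x _; apply: (phi_ext_ge0 adm thetap hom).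
have psi_ge0 : 0 <= be%:E * \int[mu]_x (psi x)%:E.
  by apply: mule_ge0; [rewrite lee_fin ltW|apply: integral_ge0 => x _; rewrite lee_fin].
have G_ge0 : 0 <= ta%:E * \int[gamma]_x (G x)%:E.
  by apply: mule_ge0; [rewrite lee_fin ltW|apply: integral_ge0 => x _; rewrite lee_fin].
rewrite integral_phi_inf.
(* If [s] charges [Z], the recession term is +oo and so is the right-hand side. Otherwise the flux
   is [w] times gamma on the ball. *)
have [sZ|sZ] := eqVneq (s Z) 0; last first.
  have sZ0 : 0 < s Z by rewrite lt0e sZ/=.
  have NN (x : \bar R) : 0 <= x -> x != -oo.
    by move=> x0; rewrite -ltNye (lt_le_trans _ x0)// ltNye.
  rewrite gt0_mulye// addey ?NN// gt0_muley ?lte_fin// -addeA addye ?leey//.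
  by rewrite NN// adde_ge0.
rewrite sZ mule0 adde0.
under eq_bigr => i _ do rewrite (flux_integral_eq sZ (iu i) (bf i)).
have iw' i : gamma.-integrable (eball 0%R r) (EFin \o (fun x => w x ord0 i)).
  apply: le_integrable (iw r); first exact: measurable_eball.
    by apply: measurable_funTS; apply/measurable_EFinP.
  by move=> x _ /=; rewrite lee_fin (ger0_norm (enorm_ge0 _)) coord_le_enorm.
have mf i : measurable_fun setT (f i) by case: (bf i).
rewrite -integral_sum//; last by move=> i; exact: bounded_supp_integrable (bf i) (iw' i).
pose S x := (\sum_(i < d) f i x * w x ord0 i)%R.
have mS : measurable_fun setT S by apply: measurable_sum => i; exact: measurable_funM.
under eq_integral do rewrite sumEFin.
apply: (le_trans (le_abse_integral _ _ _)) => //; first exact/measurable_EFinP.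
pose Q x := (be * (psi x * rho x) + ta * G x)%R.
have Q0 x : (0 <= Q x)%R by rewrite addr_ge0// !mulr_ge0// ltW.
have mQ : measurable_fun setT Q.
  by apply: measurable_funD; apply: measurable_funM => //; exact: measurable_funM.
(* A measurable minorant of the action density with |S| <= al H + Q. Additivity of the integral is
   applied to [H], and the action density is compared with it by monotonicity only. *)
pose H x := (Num.max 0 (`|S x| - Q x) / al)%R.
have mH : measurable_fun setT H.
  apply: measurable_funM => //; apply: measurable_maxr => //.
  by apply: measurable_funB => //; exact: measurableT_comp.
have H0 x : (0 <= H x)%R by rewrite divr_ge0 ?(ltW al0)// le_max lexx.
have SK x : (`|S x| <= d%:R * K * (psi x `^ (1 - theta / p) * G x `^ ((theta - 1) / p)) * enorm (w x))%R.
  apply: le_trans (ler_norm_sum _ _ _) _.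
  rewrite [leRHS](_ : _ = \sum_(i < d)
      (K * (psi x `^ (1 - theta / p) * G x `^ ((theta - 1) / p)) * enorm (w x)))%R; last first.
    by rewrite sumr_const card_ord -[RHS]mulr_natl !mulrA.
  apply: ler_sum => i _; rewrite normrM.
  by apply: ler_pM; rewrite ?fK ?coord_le_enorm.
have SHQ x : `|(S x)%:E| <= al%:E * (H x)%:E + (Q x)%:E.
  rewrite -EFinM -EFinD lee_fin /H mulrC divfK ?lt0r_neq0//.
  by rewrite -lerBlDr le_max lexx orbT.
have Hphi x : (H x)%:E <= phi_ext phi (rho x) (w x).
  have := phi_ext_young p1 adm theta1 thetap hom (w x) c00 lb al0 be0 ta0 KP (psi0 x) (G0 x) (rho0 x).
  move: (phi_ext_ge0 adm thetap hom (w x) (rho0 x)).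
  case: (phi_ext _ _ _) => [z||]; rewrite ?leey// -EFinM -EFinD !lee_fin => z0 h.
  rewrite /H ler_pdivrMr// ge_max mulr_ge0 ?(ltW al0)//= lerBlDr.
  by apply: le_trans (SK x) _; rewrite (mulrC z).
apply: (@le_trans _ _ (\int[gamma]_x (al%:E * (H x)%:E + (Q x)%:E))).
  apply: ge0_le_lower_integral => // x _; exact: SHQ.
have mH' : measurable_fun setT (EFin \o H) by exact/measurable_EFinP.
rewrite ge0_integralD//; last 4 first.
- by move=> x _; rewrite mule_ge0 ?lee_fin ?(ltW al0).
- exact: measurable_funeM.
- by move=> x _; rewrite lee_fin.
- exact/measurable_EFinP.
rewrite -[leRHS]addeA; apply: leeD.
  rewrite ge0_integralZl_EFin ?(ltW al0)//; last by move=> x _; rewrite lee_fin.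
  apply: lee_wpmul2l; first by rewrite lee_fin ltW.
  by apply: ge0_le_lower_integral => x _ //; rewrite lee_fin.
under eq_integral do rewrite EFinD !EFinM.
have mpr : measurable_fun setT (fun x => (psi x)%:E * (rho x)%:E).
  by apply: emeasurable_funM; exact/measurable_EFinP.
have mG' : measurable_fun setT (EFin \o G) by exact/measurable_EFinP.
rewrite ge0_integralD//; last 4 first.
- by move=> x _; rewrite !mule_ge0 ?lee_fin ?(ltW be0).
- exact: measurable_funeM.
- by move=> x _; rewrite mule_ge0 ?lee_fin ?(ltW ta0).
- exact: measurable_funeM.
rewrite !ge0_integralZl_EFin ?(ltW be0) ?(ltW ta0)//; last 2 first.
- by move=> x _; rewrite lee_fin.
- by move=> x _; rewrite mule_ge0// lee_fin.
rewrite leeD2r// lee_wpmul2l ?lee_fin ?(ltW be0)//.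
under eq_integral do rewrite -EFinM.
apply: integral_density_le => // A mA; rewrite muA// leeDl//.
by apply: integral_ge0 => x _; rewrite lee_fin.
Qed.

End flux.

(** * A continuously differentiable step in time *)

Section smooth_step.
Context (R : realType).
Implicit Types (x y : R).

(** A first-order expansion with quadratic error treats the kink of the positive part without
    one-sided limits. *)
Lemma is_derive_quadratic_remainder (f : R -> R) x D C :
  (forall y, `|f y - f x - D * (y - x)| <= C * (y - x) ^+ 2) -> is_derive x 1 f D.
Proof.
move=> fC.
have C0 : 0 <= C by have := fC (x + 1); rewrite (addrC x) addrK expr1n !mulr1; exact: le_trans.
have h : h^-1 *: ((f \o shift x) (h *: 1) - f x) @[h --> 0^'] --> D.
  apply/cvgrPdist_lt => e e0; near=> h.
  have h0 : h != 0 by near: h; exact: nbhs_dnbhs_neq.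
  have he : `|h| < e / (C + 1).
    near: h; apply: dnbhs0_lt; rewrite divr_gt0// ltr_wpDl//.
  rewrite /= [h *: 1]mulr1; have := fC (h + x); rewrite addrK => fh.
  have -> : D - h^-1 *: (f (h + x) - f x) = - h^-1 * (f (h + x) - f x - D * h).
    by rewrite -[h^-1 *: _]/(h^-1 * _); field.
  rewrite normrM normrN normfV mulrC ltr_pdivrMr ?normr_gt0//.
  apply: le_lt_trans fh _; rewrite -real_normK ?num_real// expr2 mulrA.
  rewrite ltr_pM2r ?normr_gt0//; move: he; rewrite ltr_pdivlMr ?ltr_wpDl// => he.
  by apply: le_lt_trans he; rewrite mulrDr mulr1 mulrC lerDl.
apply: DeriveDef; first by apply/cvg_ex; exists D.
by rewrite /derive; exact: cvg_lim h.
Unshelve. all: end_near. Qed.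

Definition sqpos x := Num.max 0 x ^+ 2.

Lemma sqpos_remainder x y :
  `|sqpos y - sqpos x - 2 * Num.max 0 x * (y - x)| <= (y - x) ^+ 2.
Proof.
rewrite /sqpos ler_norml.
have sx := sqr_ge0 x; have sy := sqr_ge0 y; have sxy := sqr_ge0 (y - x).
have [x0|x0] := leP 0 x; have [y0|y0] := leP 0 y.
- by apply/andP; split; nra.
- by have := mulr_ge0 x0 (ltW (_ : 0 < - y)); rewrite oppr_gt0 => /(_ y0) ?;
    apply/andP; split; nra.
- by have := mulr_ge0 y0 (ltW (_ : 0 < - x)); rewrite oppr_gt0 => /(_ x0) ?;
    apply/andP; split; nra.
- by rewrite !expr0n/= !mulr0 !mul0r !subr0 oppr_le0 sqr_ge0.
Qed.

Lemma continuous_pospart : continuous (fun x : R => Num.max 0 x).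
Proof. by move=> x; apply: (@continuous_max _ _ (cst 0) id x); [exact: cvg_cst|exact: cvg_id]. Qed.

(* Quadratic spline rising from 0 to 1 on [0, 1]. *)
Definition sstep x := 2 * sqpos x - 4 * sqpos (x - 2^-1) + 2 * sqpos (x - 1).
(** A tent supported in [0, 1] with height 2 at 1/2, hence of unit mass; rescaled, it is the time
    mollifier. *)
Definition dsstep x :=
  4 * Num.max 0 x - 8 * Num.max 0 (x - 2^-1) + 4 * Num.max 0 (x - 1).

Lemma is_derive_sqpos_affine a b x :
  is_derive x 1 (fun x => sqpos (a * x - b)) (2 * a * Num.max 0 (a * x - b)).
Proof.
apply: (@is_derive_quadratic_remainder _ _ _ (a ^+ 2)) => y.
have e : a * y - b = (a * x - b) + a * (y - x) by ring.
have -> : a ^+ 2 * (y - x) ^+ 2 = (a * (y - x)) ^+ 2 by rewrite exprMn.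
have -> : 2 * a * Num.max 0 (a * x - b) * (y - x) =
  2 * Num.max 0 (a * x - b) * (a * (y - x)) by ring.
have := sqpos_remainder (a * x - b) (a * y - b).
by rewrite (_ : a * y - b - (a * x - b) = a * (y - x))//; ring.
Qed.

Lemma is_derive_sstep_affine a b x :
  is_derive x 1 (fun x => sstep (a * x - b)) (a * dsstep (a * x - b)).
Proof.
rewrite /sstep.
have h1 := is_derive_sqpos_affine a b x.
have h2 := is_derive_sqpos_affine a (b + 2^-1) x.
have h3 := is_derive_sqpos_affine a (b + 1) x.
rewrite (_ : (fun _ => _) = (2 \*o (fun x => sqpos (a * x - b))
  - 4 \*o (fun x => sqpos (a * x - (b + 2^-1)))
  + 2 \*o (fun x => sqpos (a * x - (b + 1))))%R); last first.
  apply/funext => y; rewrite !fctE/=.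
  by rewrite (_ : a * y - b - 2^-1 = a * y - (b + 2^-1)) 1?(_ : a * y - b - 1 = a * y - (b + 1))//; ring.
apply: is_derive_eq; rewrite /dsstep -![_ *: _]/(_ * _) !opprD !addrA; ring.
Qed.

Lemma dsstep_ge0 x : 0 <= dsstep x.
Proof.
rewrite /dsstep; have [h1|h1] := leP 0 x; have [h2|h2] := leP 0 (x - 2^-1);
have [h3|h3] := leP 0 (x - 1); lra.
Qed.

Lemma dsstep_out x : x <= 0 \/ 1 <= x -> dsstep x = 0.
Proof.
rewrite /dsstep => -[] h; have [h1|h1] := leP 0 x; have [h2|h2] := leP 0 (x - 2^-1);
have [h3|h3] := leP 0 (x - 1); lra.
Qed.

Lemma sstep_ge0 x : 0 <= sstep x.
Proof.
rewrite /sstep/sqpos; have [h1|h1] := leP 0 x; have [h2|h2] := leP 0 (x - 2^-1);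
have [h3|h3] := leP 0 (x - 1); nra.
Qed.

Lemma sstep_le1 x : sstep x <= 1.
Proof.
rewrite /sstep/sqpos; have [h1|h1] := leP 0 x; have [h2|h2] := leP 0 (x - 2^-1);
have [h3|h3] := leP 0 (x - 1); nra.
Qed.

Lemma sstep_le0 x : x <= 0 -> sstep x = 0.
Proof.
rewrite /sstep/sqpos; have [h1|h1] := leP 0 x; have [h2|h2] := leP 0 (x - 2^-1);
have [h3|h3] := leP 0 (x - 1); nra.
Qed.

Lemma sstep_ge1 x : 1 <= x -> sstep x = 1.
Proof.
rewrite /sstep/sqpos; have [h1|h1] := leP 0 x; have [h2|h2] := leP 0 (x - 2^-1);
have [h3|h3] := leP 0 (x - 1); nra.
Qed.

Lemma continuous_dsstep_affine a b : continuous (fun x => a * dsstep (a * x - b)).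
Proof.
have c e : continuous (fun x => Num.max 0 (a * x - e)).
  move=> x; apply: (@continuous_comp _ _ _ (fun x => a * x - e) (fun x => Num.max 0 x)).
    by apply: continuousB; [apply: continuousM; [exact: cvg_cst|exact: cvg_id]|exact: cvg_cst].
  exact: continuous_pospart.
move=> x; rewrite /continuous_at /dsstep.
under eq_fun => y.
  rewrite -[a * y - b - 2^-1]addrA -opprD -[a * y - b - 1]addrA -opprD; over.
rewrite -[a * x - b - 2^-1]addrA -opprD -[a * x - b - 1]addrA -opprD.
apply: cvgM; first exact: cvg_cst.
apply: cvgD; last by apply: cvgM; [exact: cvg_cst|exact: c].
by apply: cvgB; apply: cvgM; try exact: cvg_cst; exact: c.
Qed.

End smooth_step.

(** * The continuity equation tested against a fixed spatial weight *)

Section continuity_equation.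
Context (R : realType) (d : nat) (T : R) (mu sig : R -> {measure set (Rd R d) -> \bar R})
  (u : R -> 'rV[R]_d -> 'rV[R]_d).
Hypotheses (T0 : 0 < T) (ce : CE T mu sig u).
Context (psi : 'rV[R]_d -> R) (Dpsi : 'I_d -> 'rV[R]_d -> R) (r : R).
Hypotheses (psi0 : forall x, 0 <= psi x) (cpsi : continuous psi)
  (cD : forall i, continuous (Dpsi i))
  (dpsi : forall i x, is_derive x (delta_mx ord0 i) psi (Dpsi i x))
  (spsi : forall x, r <= enorm x -> psi x = 0)
  (sD : forall i x, r <= enorm x -> Dpsi i x = 0).

Lemma continuous_bounded_supp (f : 'rV[R]_d -> R) : continuous f ->
  (forall x, r <= enorm x -> f x = 0) -> bounded_supp r f.
Proof.
move=> cf f0; split; first exact: continuous_measurable_Rd.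
- have [r0|r0] := ltP r 0.
    exists 0 => x; rewrite f0 ?normr0// (le_trans (ltW r0))//; exact: enorm_ge0.
  pose K := [set x : 'rV[R]_d | `|x| <= r].
  have K0 : K !=set0 by exists 0; rewrite /K/= normr0.
  have cK : compact K.
    apply: bounded_closed_compact; last first.
      have -> : K = (fun x => `|x|) @^-1` [set y | y <= r] by [].
      by apply: closed_comp => [x _|]; [exact: norm_continuous|exact: closed_le].
    by exists r; split => [|t rt x /= xr]; [exact: num_real|exact: le_trans xr (ltW rt)].
  have cnf : continuous (fun x => `|f x|).
    by move=> x; apply: continuous_comp; [exact: cf|exact: norm_continuous].
  have [y _ ymax] := compact_EVT_max K0 cK (continuous_subspaceT cnf).
  exists `|f y| => x; have [xr|xr] := leP `|x| r; first by apply: ymax; rewrite inE.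
  rewrite f0 ?normr0// ltW// (lt_le_trans xr)//; exact: norm_le_enorm.
- by move=> x; rewrite eball0E => /negP; rewrite -leNgt => /f0.
Qed.

Let bpsi : bounded_supp r psi. Proof. exact: continuous_bounded_supp. Qed.
Let bD i : bounded_supp r (Dpsi i).
Proof. by apply: continuous_bounded_supp => // x; exact: sD. Qed.

Definition mass_curve t := fine (\int[mu t]_x (psi x)%:E).

Local Open Scope ereal_scope.

Lemma mass_curveE t : (0 <= t <= T)%R -> \int[mu t]_x (psi x)%:E = (mass_curve t)%:E.
Proof.
move=> t0; rewrite /mass_curve fineK//.
have lf : locfin (mu t) by case: ce => -[h _] _ _ _; apply: h; rewrite /= in_itv.
have i1 : (mu t).-integrable (eball 0%R r) (EFin \o (fun _ => 1%R)).
  apply/integrableP; split; first exact: measurable_cst.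
  under eq_integral do rewrite /= normr1.
  by rewrite integral_cst ?mul1e ?lf//; exact: measurable_eball.
have := bounded_supp_integrable bpsi i1.
under eq_fun do rewrite mulr1.
exact: integrable_fin_num.
Qed.

Lemma mass_curve_ge0 t : (0 <= mass_curve t)%R.
Proof. by apply: fine_ge0; apply: integral_ge0 => x _; rewrite lee_fin. Qed.

Lemma mass_curve_continuous t e : (0 <= t <= T)%R -> (0 < e)%R ->
  exists2 dl : R, (0 < dl)%R & forall s, (0 <= s <= T)%R -> (`|s - t| < dl)%R ->
    (`|mass_curve s - mass_curve t| < e)%R.
Proof.
move=> t0 e0; case: ce => -[_ /(_ psi cpsi) h] _ _ _.
have {h} : {within `[0%R, T]%classic, continuous (fun t => \int[mu t]_x (psi x)%:E)}.
  by apply: h; exists r => x; exact: spsi.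
move=> /subspace_continuousP /(_ t); rewrite /= in_itv/= => /(_ t0).
rewrite /from_subspace /= mass_curveE// => /fine_cvgP[_] /cvgrPdist_lt /(_ _ e0).
rewrite near_withinE => -[dl /= dl0 h]; exists dl => // s s0 st.
rewrite distrC; apply: h => //=; first by rewrite distrC.
Qed.

Lemma flux_coord_integrable t i : (0 < t < T)%R ->
  (sig t).-integrable (eball 0%R r) (fun x => (u t x ord0 i)%:E).
Proof.
move=> t0; case: ce => _ [/(_ t)]; rewrite /= in_itv/= => /(_ t0) [_ mu_ fin] _ _ _.
have iu : (sig t).-integrable (eball 0%R r) (fun x => (enorm (u t x))%:E).
  apply/integrableP; split.
    by apply: measurable_funTS; apply/measurable_EFinP; exact: measurable_enorm.
  under eq_integral do rewrite gee0_abs ?lee_fin ?enorm_ge0//.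
  exact: fin.
apply: le_integrable iu; first exact: measurable_eball.
  by apply: measurable_funTS; apply/measurable_EFinP.
by move=> x _ /=; rewrite lee_fin (ger0_norm (enorm_ge0 _)) coord_le_enorm.
Qed.

(** Formally the time derivative of [mass_curve]. The sum stands outside the integrals because [CE]
    provides measurability in time for each coordinate separately. *)
Definition flux_curve t : \bar R :=
  \sum_(i < d) \int[sig t]_x (Dpsi i x * u t x ord0 i)%:E.

Lemma measurable_flux_curve : measurable_fun `]0%R, T[%classic flux_curve.
Proof.
apply: emeasurable_sum => i.
apply: (@bounded_supp_integral_measurable _ _ sig (fun t x => u t x ord0 i) _ r) => //.
- by move=> t; rewrite /= in_itv/= => t0; exact: flux_coord_integrable.
- move=> A mA Ar; case: ce => _ [_ h] _ _; apply: h => //.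
  by exists r.
Qed.

Lemma measurable_mass_curve : measurable_fun `]0%R, T[%classic mass_curve.
Proof.
apply: open_continuous_measurable_fun; first exact: interval_open.
move=> t; rewrite inE/= in_itv/= => /andP[t0 tT].
apply/cvgrPdist_lt => e e0.
have [|dl dl0 h] := @mass_curve_continuous t e _ e0; first by rewrite !ltW.
have e1 : \forall s \near t, (0 < s)%R by exact: lt_nbhsr.
have e2 : \forall s \near t, (s < T)%R by exact: lt_nbhsl.
near=> s; rewrite distrC; apply: h.
  by apply/andP; split; apply: ltW; near: s.
by rewrite distrC; near: s; exists dl.
Unshelve. all: end_near. Qed.

(** Separated variables psi(x) chi(t) turn the equation into the scalar statement that the mass
    curve has [flux_curve] as its distributional derivative on ]0, T[. *)
Lemma CE_product (chi dchi : R -> R) (a b : R) :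
  (0 < a)%R -> (a < b)%R -> (b < T)%R ->
  (forall t, is_derive (t : R) (1%R : R) chi (dchi t)) -> continuous dchi ->
  (forall t, (t < a \/ b < t)%R -> chi t = 0%R) ->
  \int[lebesgue_measure]_(t in `]0%R, T[%classic) (dchi t * mass_curve t)%:E +
  \int[lebesgue_measure]_(t in `]0%R, T[%classic) ((chi t)%:E * flux_curve t) = 0.
Proof.
move=> a0 ab bT dchiE cdchi chi0.
have cchi : continuous chi.
  move=> t; apply: differentiable_continuous; apply/derivable1_diffP.
  by have := dchiE t; case.
pose zeta (x : 'rV[R]_d) t := (psi x * chi t)%R.
have dt x (t : R) : is_derive t (1%R : R) (zeta x) (psi x * dchi t)%R.
  exact: (@is_deriveZ _ _ _ chi (psi x) t 1%R (dchi t)).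
have dx i x t : is_derive x (delta_mx ord0 i) (fun y => zeta y t) (chi t * Dpsi i x)%R.
  rewrite (_ : (fun y => zeta y t) = chi t *: psi); last first.
    by apply/funext => y; rewrite /zeta mulrC.
  exact: (@is_deriveZ _ _ _ psi (chi t) x _ (Dpsi i x)).
have dtE x t : dtime zeta x t = (psi x * dchi t)%R by exact: derive_val.
have gE x t i : grad zeta x t ord0 i = (chi t * Dpsi i x)%R.
  by rewrite /grad mxE; exact: derive_val.
have cc (f : 'rV[R]_d -> R) (h : R -> R) : continuous f -> continuous h ->
    continuous (fun z : 'rV[R]_d * R => f z.1 * h z.2)%R.
  move=> cf ch z; apply: continuousM.
    by apply: continuous_comp; [exact: cvg_fst|exact: cf].
  by apply: continuous_comp; [exact: cvg_snd|exact: ch].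
have tf : testfun T zeta.
  split.
  - by move=> x t; have := dt x t; case.
  - by move=> x t i; have := dx i x t; case.
  - split; first exact: cc.
    by under eq_fun do rewrite dtE; exact: cc.
  - move=> i; under eq_fun do rewrite gE mulrC.
    by apply: cc => //; exact: cD.
  - exists r, a, b; split => // x t [xr|tab]; rewrite /zeta.
      by rewrite spsi ?mul0r.
    by rewrite chi0 ?mulr0.
case: ce => _ _ _ /(_ _ tf) <-; congr (_ + _); apply: eq_integral => t;
  rewrite inE/= in_itv/= => t0.
- under [RHS]eq_integral do rewrite dtE mulrC EFinM.
  have t0' : (0 <= t <= T)%R by case/andP: t0 => /ltW -> /ltW ->.
  rewrite integralZl//; first by rewrite mass_curveE.
  apply/integrableP; split.
    by apply/measurable_EFinP; case: bpsi.
  under eq_integral do rewrite gee0_abs ?lee_fin//.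
  by rewrite mass_curveE// ltry.
- under [RHS]eq_integral.
    move=> x _; rewrite /dotv.
    under eq_bigr do rewrite gE -mulrA.
    rewrite -mulr_sumr EFinM -sumEFin; over.
  have iD i : (sig t).-integrable setT (fun x => (Dpsi i x * u t x ord0 i)%:E).
    by apply: (@bounded_supp_integrable _ _ _ r _ (fun x => u t x ord0 i)) => //; exact: flux_coord_integrable.
  rewrite integralZl//; last exact: integrable_sum.
  by rewrite integral_sum.
Qed.

End continuity_equation.

Section mass_increment.
Context (R : realType) (d : nat) (T : R) (mu sig : R -> {measure set (Rd R d) -> \bar R})
  (u : R -> 'rV[R]_d -> 'rV[R]_d).
Hypotheses (T0 : 0 < T) (ce : CE T mu sig u).
Context (psi : 'rV[R]_d -> R) (Dpsi : 'I_d -> 'rV[R]_d -> R) (r : R).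
Hypotheses (psi0 : forall x, 0 <= psi x) (cpsi : continuous psi)
  (cD : forall i, continuous (Dpsi i))
  (dpsi : forall i x, is_derive x (delta_mx ord0 i) psi (Dpsi i x))
  (spsi : forall x, r <= enorm x -> psi x = 0)
  (sD : forall i x, r <= enorm x -> Dpsi i x = 0).

Let m := mass_curve mu psi.
Let g := flux_curve sig u Dpsi.
Let leb := @lebesgue_measure R.
Let D : set R := `]0, T[%classic.

(** A unit-mass bump living on [tau, tau + eps], the derivative of a rescaled [sstep] rising from 0
    to 1 there. *)
Let kern tau eps (s : R) := eps^-1 * dsstep (eps^-1 * s - eps^-1 * tau).

Let kern_ge0 tau eps s : 0 < eps -> 0 <= kern tau eps s.
Proof. by move=> e0; rewrite mulr_ge0 ?dsstep_ge0// invr_ge0 ltW. Qed.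

Let kern_out tau eps s : 0 < eps -> s <= tau \/ tau + eps <= s -> kern tau eps s = 0.
Proof.
move=> e0 h; rewrite /kern dsstep_out ?mulr0// -mulrBr; case: h => h; [left|right].
  by rewrite pmulr_rle0 ?invr_gt0// subr_le0.
by rewrite ler_pdivlMl// mulr1 lerBrDl.
Qed.

Let kern_cont tau eps : continuous (kern tau eps).
Proof. exact: continuous_dsstep_affine. Qed.

Let kern_meas tau eps (A : set R) : measurable_fun A (kern tau eps).
Proof. by apply: measurable_funTS; apply: continuous_measurable_fun; exact: kern_cont. Qed.

Local Open Scope ereal_scope.

Let kern_int tau eps : (0 < tau)%R -> (0 < eps)%R -> (tau + eps < T)%R ->
  \int[leb]_(s in D) (kern tau eps s)%:E = 1.
Proof.
move=> tau0 e0 teT.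
pose F (s : R) := sstep (eps^-1 * s - eps^-1 * tau)%R.
have dF s : is_derive (s : R) (1%R : R) F (kern tau eps s) by exact: is_derive_sstep_affine.
have cF : continuous F.
  by move=> s; apply: differentiable_continuous; apply/derivable1_diffP; case: (dF s).
have := @continuous_FTC2 R (kern tau eps) F tau (tau + eps)%R.
rewrite ltrDl e0 => /(_ isT).
rewrite /F -!mulrBr addrAC subrr add0r mulVf ?lt0r_neq0// mulr0.
rewrite sstep_ge1// sstep_le0// sube0 => <-.
- rewrite integral_mkcond [RHS]integral_mkcond; apply: eq_integral => s _.
  rewrite !patchE; case: ifPn => sD'; case: ifPn => sI //.
  + rewrite notin_setE/= in_itv/= in sI; rewrite kern_out//.
    by have [|st] := leP s tau; [left|right; rewrite leNgt; apply/negP => h; apply: sI; rewrite !ltW].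
  + rewrite inE/= in_itv/= in sI; rewrite notin_setE /D/= in_itv/= in sD'.
    exfalso; apply: sD'; case/andP: sI => h1 h2.
    by rewrite (lt_le_trans tau0)//= (le_lt_trans h2).
- exact/continuous_subspaceT/kern_cont.
- split => [s _||]; first by case: (dF s).
  + exact/cvg_at_right_filter/cF.
  + exact/cvg_at_left_filter/cF.
- by move=> s _; rewrite derive1E; case: (dF s).
Qed.

Let mD : measurable D. Proof. exact: measurable_itv. Qed.

Let mm : measurable_fun D m.
Proof. exact: (measurable_mass_curve ce cpsi spsi). Qed.

Let m_ge0 t : (0 <= m t)%R. Proof. exact: mass_curve_ge0. Qed.

(** An average of [m] against unit mass deviates from [m tau] by at most the oscillation. Naming it
    as a real [a] lets the later subtractions take place in R. *)
Let kern_mass tau eps eta : (0 < tau)%R -> (0 < eps)%R -> (tau + eps < T)%R ->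
  (0 < eta)%R ->
  (forall s, tau <= s <= tau + eps -> `|m s - m tau| <= eta)%R ->
  exists a : R, [/\ \int[leb]_(s in D) (kern tau eps s * m s)%:E = a%:E,
    leb.-integrable D (fun s => (kern tau eps s * m s)%:E) &
    (m tau - eta <= a <= m tau + eta)%R].
Proof.
move=> tau0 e0 teT eta0 osc.
have mk : measurable_fun D (fun s => (kern tau eps s * m s)%:E).
  by apply/measurable_EFinP; exact: measurable_funM.
have mk1 : measurable_fun D (fun s => (kern tau eps s)%:E) by exact/measurable_EFinP.
have k0 s : 0 <= (kern tau eps s)%:E by rewrite lee_fin kern_ge0.
have km0 s : 0 <= (kern tau eps s * m s)%:E by rewrite lee_fin mulr_ge0 ?kern_ge0.
have up : \int[leb]_(s in D) (kern tau eps s * m s)%:E <= (m tau + eta)%:E.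
  have -> : (m tau + eta)%:E = \int[leb]_(s in D) ((m tau + eta)%:E * (kern tau eps s)%:E).
    rewrite ge0_integralZl_EFin ?kern_int ?mule1//.
    by rewrite addr_ge0// ltW.
  apply: ge0_le_lower_integral => // s _; rewrite -EFinM lee_fin mulrC.
  have [/andP[s1 s2]|/negP sout] := boolP (tau <= s <= tau + eps)%R.
    rewrite ler_wpM2r ?kern_ge0//; have := osc s; rewrite s1 s2 => /(_ isT).
    by rewrite ler_norml lerBlDl => /andP[].
  rewrite kern_out ?mulr0//.
  have [|st] := leP s tau; [by left|right; rewrite leNgt; apply/negP => h; apply: sout].
  by rewrite !ltW.
have lo : (m tau)%:E <= \int[leb]_(s in D) (kern tau eps s * m s)%:E + eta%:E.
  have -> : eta%:E = \int[leb]_(s in D) (eta%:E * (kern tau eps s)%:E).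
    by rewrite ge0_integralZl_EFin ?kern_int ?mule1// ltW.
  have -> : (m tau)%:E = \int[leb]_(s in D) ((m tau)%:E * (kern tau eps s)%:E).
    by rewrite ge0_integralZl_EFin ?kern_int ?mule1// ltW.
  rewrite -ge0_integralD//; last 2 first.
  - by move=> s _; rewrite mule_ge0// lee_fin ltW.
  - exact: measurable_funeM.
  apply: ge0_le_lower_integral => [s _|s _]; first by rewrite mule_ge0// lee_fin.
  rewrite -!EFinM -EFinD lee_fin mulrC -(mulrC (kern _ _ _)) -mulrDr.
  have [/andP[s1 s2]|/negP sout] := boolP (tau <= s <= tau + eps)%R.
    rewrite ler_wpM2l ?kern_ge0//; have := osc s; rewrite s1 s2 => /(_ isT).
    by rewrite ler_norml => /andP[h _]; lra.
  rewrite kern_out ?mul0r//.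
  have [|st] := leP s tau; [by left|right; rewrite leNgt; apply/negP => h; apply: sout].
  by rewrite !ltW.
have ge0 : 0 <= \int[leb]_(s in D) (kern tau eps s * m s)%:E by exact: integral_ge0.
have fin : \int[leb]_(s in D) (kern tau eps s * m s)%:E \is a fin_num.
  by rewrite ge0_fin_numE// (le_lt_trans up)// ltry.
exists (fine (\int[leb]_(s in D) (kern tau eps s * m s)%:E)); split.
- by rewrite fineK.
- apply/integrableP; split => //.
  under eq_integral do rewrite gee0_abs//.
  by rewrite (le_lt_trans up)// ltry.
- move: up lo; rewrite -{1 2}(fineK fin) lee_fin -EFinD lee_fin => h1 h2.
  by rewrite h1 andbT lerBlDr.
Qed.

(** The test function rises just after [t1] and falls just after [t2]. Its derivative compares
    averages of [m] at these times, while its values are bounded by 1 against the flux. *)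
Lemma mass_increment_interior (I t1 t2 : R) : (0 < t1)%R -> (t1 < t2)%R -> (t2 < T)%R ->
  \int[leb]_(t in D) `|g t| <= I%:E -> (`|m t2 - m t1| <= I)%R.
Proof.
move=> t10 t12 t2T gI; apply/ler_addgt0Pr => e e0.
pose eta := (e / 4)%R; have eta0 : (0 < eta)%R by rewrite divr_gt0.
have t1I : (0 <= t1 <= T)%R by rewrite (ltW t10) ltW// (lt_trans t12).
have t2I : (0 <= t2 <= T)%R by rewrite (ltW t2T) ltW// (lt_trans t10).
have [dl1 dl10 h1] := mass_curve_continuous ce cpsi spsi t1I eta0.
have [dl2 dl20 h2] := mass_curve_continuous ce cpsi spsi t2I eta0.
pose eps := (Num.min (Num.min dl1 dl2) (T - t2) / 2)%R.
(* [eps] is below both continuity radii, to control the averages, and below T - t2, to keep the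
   support of [chi] inside ]0, T[. *)
have [e1 e2 e3 eps0] : [/\ eps < dl1, eps < dl2, eps < T - t2 & 0 < eps]%R.
  have Mp : (0 < Num.min (Num.min dl1 dl2) (T - t2))%R.
    by rewrite !lt_min dl10 dl20 subr_gt0.
  have : (eps < Num.min (Num.min dl1 dl2) (T - t2))%R.
    by rewrite /eps ltr_pdivrMr// mulr_natr mulr2n ltrDl.
  by rewrite !lt_min -andbA => /and3P[? ? ?]; split => //; rewrite divr_gt0.
have osc t dl : (0 < t)%R -> (t + eps < T)%R -> (eps < dl)%R ->
    (forall s : R, (0 <= s <= T)%R -> (`|s - t| < dl)%R -> (`|m s - m t| < eta)%R) ->
    (forall s, t <= s <= t + eps -> `|m s - m t| <= eta)%R.
  move=> t0 tT edl h s /andP[s1 s2]; apply: ltW; apply: h.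
    by rewrite (le_trans (ltW t0))//= (le_trans s2)// ltW.
  by rewrite ger0_norm ?subr_ge0// (le_lt_trans _ edl)// lerBlDl.
have t2e : (t2 + eps < T)%R by rewrite -ltrBrDl.
have t1e : (t1 + eps < T)%R by rewrite (lt_trans _ t2e)// ltrD2r.
have t20 : (0 < t2)%R by exact: lt_trans t12.
have [a1 [a1E i1 /andP[a1l a1u]]] := kern_mass t10 eps0 t1e eta0 (osc _ _ t10 t1e e1 h1).
have [a2 [a2E i2 /andP[a2l a2u]]] := kern_mass t20 eps0 t2e eta0 (osc _ _ t20 t2e e2 h2).
pose chi (s : R) := (sstep (eps^-1 * s - eps^-1 * t1) - sstep (eps^-1 * s - eps^-1 * t2))%R.
pose dchi (s : R) := (kern t1 eps s - kern t2 eps s)%R.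
have dchiE (t : R) : is_derive t (1%R : R) chi (dchi t).
  by apply: is_deriveB; exact: is_derive_sstep_affine.
have cdchi : continuous dchi by move=> t; apply: continuousB; exact: kern_cont.
have chi0 (t : R) : (t < t1 \/ t2 + eps < t)%R -> chi t = 0%R.
  move=> [h|h]; rewrite /chi -!mulrBr.
    rewrite !sstep_le0 ?subrr// pmulr_rle0 ?invr_gt0// subr_le0 ltW//.
    exact: lt_trans t12.
  rewrite !sstep_ge1 ?subrr// ler_pdivlMl// mulr1 lerBrDl ltW//.
  by rewrite (lt_trans _ h)// ltrD2r.
have chi1 t : (`|chi t| <= 1)%R.
  have := sstep_ge0 (eps^-1 * t - eps^-1 * t1)%R; have := sstep_ge0 (eps^-1 * t - eps^-1 * t2)%R.
  have := sstep_le1 (eps^-1 * t - eps^-1 * t1)%R; have := sstep_le1 (eps^-1 * t - eps^-1 * t2)%R.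
  by rewrite /chi ler_norml => ? ? ? ?; apply/andP; split; lra.
have t1t2e : (t1 < t2 + eps)%R by rewrite (lt_trans t12)// ltrDl.
have := CE_product ce psi0 cpsi cD dpsi spsi sD t10 t1t2e t2e dchiE cdchi chi0.
have -> : \int[lebesgue_measure]_(t in `]0%R, T[%classic) (dchi t * mass_curve mu psi t)%:E = (a1 - a2)%:E.
  under eq_integral do rewrite /dchi mulrBl EFinB.
  by rewrite integralB// a1E a2E.
have mchi : measurable_fun D chi.
  apply: measurable_funTS; apply: continuous_measurable_fun => t.
  apply: differentiable_continuous; apply/derivable1_diffP.
  by have := dchiE t; case.
have mg : measurable_fun D g by exact: (measurable_flux_curve ce cD sD).
have : `|\int[lebesgue_measure]_(t in `]0%R, T[%classic) ((chi t)%:E * flux_curve sig u Dpsi t)| <= I%:E.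
  apply: le_trans gI; apply: (le_trans (le_abse_integral _ _ _)) => //.
    by apply: emeasurable_funM => //; exact/measurable_EFinP.
  apply: ge0_le_lower_integral => // t _.
  rewrite abseM -[leRHS]mul1e; apply: lee_wpmul2r => //.
  by rewrite /= lee_fin.
case: (\int[lebesgue_measure]_(t in _) (_ * _)) => [z||] //=; rewrite lee_fin => zI.
move=> /eqP; rewrite -EFinD eqe addr_eq0 => /eqP az.
have : (`|a1 - a2| <= I)%R by rewrite az normrN.
have e4 : (e = eta * 4)%R by rewrite /eta divfK.
rewrite !ler_norml e4 => /andP[h3 h4]; apply/andP; split; lra.
Qed.

(** The equation sees only the open interval; weak continuity of the curve adds the endpoints. *)
Lemma mass_increment (I t : R) : (0 <= t <= T)%R ->
  \int[leb]_(t in D) `|g t| <= I%:E -> (`|m t - m 0%R| <= I)%R.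
Proof.
move=> tI gI; apply/ler_addgt0Pr => e e0.
have e20 : (0 < e / 2)%R by rewrite divr_gt0.
have near_int s : (0 <= s <= T)%R -> exists2 s', (0 < s' < T)%R & (`|m s' - m s| < e / 2)%R.
  move=> sI; have [dl dl0 h] := mass_curve_continuous ce cpsi spsi sI e20.
  (* Moving [s] by a small fraction [l] of its way to the midpoint T / 2 enters the open interval
     from either end. *)
  pose l := Num.min (2^-1)%R (dl / (2 * T))%R.
  have [l0 l1 l2] : [/\ 0 < l, l < 1 & l * T < dl]%R.
    split.
    - by rewrite lt_min invr_gt0 ltr0n/= divr_gt0// mulr_gt0.
    - by rewrite gt_min invf_lt1// ltr1n.
    - apply: (@le_lt_trans _ _ (dl / (2 * T) * T)%R).
        by rewrite ler_wpM2r ?(ltW T0)// ge_min lexx orbT.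
      rewrite invfM mulrA divfK ?lt0r_neq0// ltr_pdivrMr// mulr_natr mulr2n.
      by rewrite ltrDl.
  case/andP: sI => s0 sT; exists (s + l * (T / 2 - s))%R.
    have e1 : (s + l * (T / 2 - s) = (1 - l) * s + l * (T / 2))%R by ring.
    have q1 : (0 <= (1 - l) * s)%R by rewrite mulr_ge0// subr_ge0 ltW.
    have q2 : ((1 - l) * s <= (1 - l) * T)%R by rewrite ler_wpM2l// subr_ge0 ltW.
    have q3 : (0 < l * T)%R by rewrite mulr_gt0.
    rewrite e1; apply/andP; split; nra.
  have q4 : (l * s <= l * T)%R by rewrite ler_wpM2l// ltW.
  have q5 : (0 <= l * s)%R by rewrite mulr_ge0// ltW.
  have q3 : (0 < l * T)%R by rewrite mulr_gt0.
  apply: h.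
    have e1 : (s + l * (T / 2 - s) = (1 - l) * s + l * (T / 2))%R by ring.
    have q1 : (0 <= (1 - l) * s)%R by rewrite mulr_ge0// subr_ge0 ltW.
    have q2 : ((1 - l) * s <= (1 - l) * T)%R by rewrite ler_wpM2l// subr_ge0 ltW.
    rewrite e1; apply/andP; split; nra.
  rewrite addrC addKr; apply: le_lt_trans l2.
  by rewrite ler_norml; apply/andP; split; nra.
have [t' /andP[t'0 t'T] ht] := near_int _ tI.
have [z' /andP[z'0 z'T] hz] : exists2 s', (0 < s' < T)%R & (`|m s' - m 0%R| < e / 2)%R.
  by apply: near_int; rewrite lexx ltW.
have I0 : (0 <= I)%R by rewrite -lee_fin (le_trans _ gI)//; exact: integral_ge0.
have h : (`|m t' - m z'| <= I)%R.
  have [tz|zt|->] := ltgtP t' z'; last by rewrite subrr normr0.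
    by rewrite distrC; exact: mass_increment_interior.
  exact: mass_increment_interior.
have -> : (m t - m 0%R = (m t' - m z') - (m t' - m t) + (m z' - m 0%R))%R by ring.
apply: le_trans (ler_normD _ _) _.
have := ler_normD (m t' - m z')%R (- (m t' - m t))%R; rewrite normrN.
by have := ltW ht; have := ltW hz; rewrite (splitr e); lra.
Qed.

End mass_increment.

(** * Integration in time of the flux bound *)

Section energy_increment.
Context (R : realType) (d : nat) (phi : R -> 'rV[R]_d -> R) (p theta T : R).
Hypotheses (p1 : 1 < p) (adm : admissible p phi) (theta1 : 1 < theta)
  (thetap : theta <= p) (hom : homogeneous theta phi) (T0 : 0 < T).
Context (gamma : {measure set (Rd R d) -> \bar R})
  (mu sig : R -> {measure set (Rd R d) -> \bar R}) (u : R -> 'rV[R]_d -> 'rV[R]_d).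
Hypothesis ce : CE T mu sig u.
Context (psi : 'rV[R]_d -> R) (Dpsi : 'I_d -> 'rV[R]_d -> R) (r : R).
Hypotheses (psi0 : forall x, 0 <= psi x) (cpsi : continuous psi)
  (cD : forall i, continuous (Dpsi i))
  (dpsi : forall i x, is_derive x (delta_mx ord0 i) psi (Dpsi i x))
  (spsi : forall x, r <= enorm x -> psi x = 0)
  (sD : forall i x, r <= enorm x -> Dpsi i x = 0).
Context (c0 K al be ta M : R) (G : Rd R d -> R).
Hypotheses (c00 : 0 < c0)
  (lb : forall rho w, 0 < rho -> c0 * (rho `^ (theta - p) * enorm w `^ p) <= phi rho w)
  (al0 : 0 < al) (be0 : 0 < be) (ta0 : 0 < ta)
  (KP : d%:R * K <= (al * c0) `^ p^-1 * (be `^ (1 - theta / p) * ta `^ ((theta - 1) / p)))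
  (mG : measurable_fun setT G) (G0 : forall x, 0 <= G x)
  (DK : forall i x, `|Dpsi i x| <= K * (psi x `^ (1 - theta / p) * G x `^ ((theta - 1) / p)))
  (Gfin : (\int[gamma]_x (G x)%:E < +oo)%E)
  (Efin : (energy phi gamma T mu sig u < +oo)%E)
  (MP : forall t, 0 <= t <= T -> mass_curve mu psi t <= M).

Let C := be * M + ta * fine (\int[gamma]_x (G x)%:E).

Local Open Scope ereal_scope.

Lemma Phi_ge0 (m s : {measure set (Rd R d) -> \bar R}) (v : 'rV[R]_d -> 'rV[R]_d) :
  0 <= Phi phi gamma m s v.
Proof.
rewrite /Phi; case: ifPn => // _; apply: le_ereal_inf_tmp => _ [rho [w [s' [rhop [wp [dec ->]]]]]].
rewrite (integral_phi_inf p1 adm theta1 thetap hom dec); apply: adde_ge0 => //.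
case: dec => -[_ _ [rho0 _] _ _] _.
by apply: integral_ge0 => x _; apply: (phi_ext_ge0 adm thetap hom).
Qed.

(** The flux bound solved for the action: the lower bound [h] is the same for all decompositions at
    time [t], so it survives the infimum in [Phi]. *)
Lemma flux_curve_bound t h : (0 < t < T)%R ->
  `|flux_curve sig u Dpsi t| = (al * h + C)%:E ->
  h%:E <= Phi phi gamma (mu t) (sig t) (u t).
Proof.
move=> t0 gh; rewrite /Phi; case: ifPn => [_|]; last by rewrite leey.
apply: le_ereal_inf_tmp => _ [rho [w [s' [rhop [wp [dec ->]]]]]].
have mpsi : measurable_fun setT (psi : Rd R d -> R) by exact: continuous_measurable_Rd.
have bD i : bounded_supp r (Dpsi i).
  by apply: continuous_bounded_supp => // x; exact: sD.
set v0 := (X in _ <= X).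
have : `|flux_curve sig u Dpsi t| <= al%:E * v0 + be%:E * \int[mu t]_x (psi x)%:E +
    ta%:E * \int[gamma]_x (G x)%:E := flux_bound p1 adm theta1 thetap hom dec c00 lb al0 be0 ta0 KP mpsi psi0 mG G0
  bD (fun i => flux_coord_integrable ce r i t0) DK.
have t0' : (0 <= t <= T)%R by case/andP: t0 => /ltW -> /ltW ->.
have Gf : \int[gamma]_x (G x)%:E \is a fin_num.
  by rewrite ge0_fin_numE//; apply: integral_ge0 => x _; rewrite lee_fin.
rewrite gh (mass_curveE ce cpsi spsi t0') -(fineK Gf).
case: v0 => [v||]; rewrite ?leey//; last first.
  by rewrite gt0_muleNy ?lte_fin// addeAC -!EFinM -EFinD addeNy.
rewrite -!EFinM -!EFinD !lee_fin => hle.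
have {}hle : (al * h <= al * v)%R.
  have := MP t0'; rewrite -(ler_pM2l be0) => h2.
  by move: hle; rewrite /C; lra.
by move: hle; rewrite ler_pM2l.
Qed.

Lemma energy_ge0 : 0 <= energy phi gamma T mu sig u.
Proof. by apply: integral_ge0 => t _; exact: Phi_ge0. Qed.

Lemma flux_curve_integral :
  \int[lebesgue_measure]_(t in `]0%R, T[%classic) `|flux_curve sig u Dpsi t| <=
  (al * fine (energy phi gamma T mu sig u) + T * C)%:E.
Proof.
pose D : set R := `]0%R, T[%classic.
have mD : measurable D by exact: measurable_itv.
pose g t := fine `|flux_curve sig u Dpsi t|.
have gE t : D t -> `|flux_curve sig u Dpsi t| = (g t)%:E.
  rewrite /D/= in_itv/= => t0; rewrite /g fineK// fin_num_abs abse_id -fin_num_abs.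
  apply/sum_fin_numP => i _ _.
  apply: integrable_fin_num => //.
  apply: (@bounded_supp_integrable _ _ _ r _ (fun x => u t x ord0 i)).
    by apply: continuous_bounded_supp => // x; exact: sD.
  exact: (flux_coord_integrable ce r i t0).
have mg : measurable_fun D g.
  apply: (measurableT_comp (fine_measurable measurableT)).
  apply: measurableT_comp => //.
  exact: (measurable_flux_curve ce cD sD).
(* The counterpart in time of the minorant used in space: it is measurable because the flux curve
   is, and it lies below the action at every time. *)
pose h t := (Num.max 0 (g t - C) / al)%R.
have mh : measurable_fun D h.
  by apply: measurable_funM => //; apply: measurable_maxr => //; exact: measurable_funB.
have h0 t : (0 <= h t)%R by rewrite divr_ge0 ?(ltW al0)// le_max lexx.
have C0 : (0 <= C)%R.
  rewrite addr_ge0// mulr_ge0 ?(ltW be0) ?(ltW ta0)//.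
    by apply: (le_trans (mass_curve_ge0 mu psi0 0%R)); apply: MP; rewrite lexx ltW.
  by apply: fine_ge0; apply: integral_ge0 => x _; rewrite lee_fin.
have hPhi t : D t -> (h t)%:E <= Phi phi gamma (mu t) (sig t) (u t).
  move=> Dt; rewrite /h; have [gC|gC] := leP (g t - C)%R 0%R.
    by rewrite mul0r Phi_ge0.
  apply: flux_curve_bound; first by move: Dt; rewrite /D/= in_itv.
  by rewrite gE// mulrC divfK ?lt0r_neq0// subrK.
apply: (@le_trans _ _ (\int[lebesgue_measure]_(t in D) (al%:E * (h t)%:E + C%:E))).
  apply: ge0_le_lower_integral => // t Dt; rewrite gE// -EFinM -EFinD lee_fin /h.
  by rewrite mulrC divfK ?lt0r_neq0// -lerBlDr le_max lexx orbT.
have mh' : measurable_fun D (fun t => (h t)%:E) by exact/measurable_EFinP.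
rewrite ge0_integralD//; last 2 first.
- by move=> t _; apply: mule_ge0; rewrite lee_fin ?(ltW al0).
- exact: measurable_funeM.
rewrite [leRHS]EFinD; apply: leeD; last first.
  have -> : \int[lebesgue_measure]_(t in D) C%:E = C%:E * lebesgue_measure D.
    exact: integral_cst.
  by rewrite lebesgue_measure_itv/= lte_fin T0 sube0 -EFinM mulrC.
rewrite ge0_integralZl_EFin ?(ltW al0)//; last by move=> t _; rewrite lee_fin.
rewrite EFinM fineK; last by rewrite ge0_fin_numE// energy_ge0.
apply: lee_wpmul2l; first by rewrite lee_fin ltW.
by apply: ge0_le_lower_integral => t Dt; [rewrite lee_fin|exact: hPhi].
Qed.

Lemma energy_increment t : (0 <= t <= T)%R ->
  (`|mass_curve mu psi t - mass_curve mu psi 0| <=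
   al * fine (energy phi gamma T mu sig u) +
   T * (be * M + ta * fine (\int[gamma]_x (G x)%:E)))%R.
Proof.
move=> tI; apply: (mass_increment T0 ce psi0 cpsi cD dpsi spsi sD tI).
exact: flux_curve_integral.
Qed.

End energy_increment.

(** * Truncated weights and their gradients *)

Section truncated_weight.
Context (R : realType) (d : nat).

(** The difference quotients coincide, so directional derivatives reduce to calculus in one
    variable. *)
Lemma is_derive_line (f : 'rV[R]_d -> R) (x v : 'rV[R]_d) D :
  is_derive (0 : R) (1 : R) (fun t : R => f (t *: v + x)) D -> is_derive x v f D.
Proof.
case; rewrite /derivable /derive => dv De.
have e : (fun h : R => h^-1 *: (((fun t : R => f (t *: v + x)) \o shift 0) (h *: 1) - f (0 *: v + x))) =
    (fun h : R => h^-1 *: ((f \o shift x) (h *: v) - f x)).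
  by apply/funext => h /=; rewrite addr0 scale0r add0r [h *: 1]mulr1.
by rewrite e in dv De; apply: DeriveDef.
Qed.

(** A smooth substitute for the square of max(1, |x|), which is why moment exponents are halved
    throughout. *)
Definition jbr (x : 'rV[R]_d) : R := 1 + enorm x ^+ 2.

Lemma jbr_ge1 x : 1 <= jbr x. Proof. by rewrite lerDl sqr_ge0. Qed.

Lemma jbr_gt0 x : 0 < jbr x. Proof. exact: lt_le_trans (jbr_ge1 x). Qed.

Lemma continuous_jbr : continuous jbr.
Proof.
move=> x; apply: (@continuousD R R^o 'rV[R]_d (cst 1) (fun x => enorm x ^+ 2) x).
  exact: (@cst_continuous 'rV[R]_d R 1 x).
exact: (@continuous_sqr_enorm R d x).
Qed.

Lemma jbr_line x i (t : R) :
  jbr (t *: delta_mx ord0 i + x) = jbr x + 2 * x ord0 i * t + t ^+ 2.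
Proof.
rewrite /jbr !sqr_enorm (bigD1 i)//= [in RHS](bigD1 i)//= !mxE !eqxx mulr1.
rewrite (eq_bigr (fun k => x ord0 k ^+ 2)) => [|k ki]; first by ring.
by rewrite !mxE (negbTE ki) andbF mulr0 add0r.
Qed.

Lemma coord_le_jbr (x : 'rV[R]_d) i : `|x ord0 i| <= jbr x `^ 2^-1.
Proof.
apply: le_trans (coord_le_enorm x i) _.
rewrite powR12_sqrt ?(ltW (jbr_gt0 x))// -[leLHS]ger0_norm ?enorm_ge0//.
rewrite -sqrtr_sqr; apply: ler_wsqrtr; by rewrite /jbr lerDr.
Qed.

Context (delta N : R) (j : nat).
Hypothesis N1 : 1 <= N.
Let N0 : 0 < N. Proof. exact: lt_le_trans N1. Qed.

Definition cutoff (s : R) := Num.max 0 (1 - s / N).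

Lemma cutoff_ge0 s : 0 <= cutoff s. Proof. by rewrite le_max lexx. Qed.

Lemma cutoff_le1 s : 0 <= s -> cutoff s <= 1.
Proof. by move=> s0; rewrite ge_max ler01/= gerBl divr_ge0// ltW. Qed.

Lemma cutoff_eq0 s : N <= s -> cutoff s = 0.
Proof. by move=> Ns; apply/max_idPl; rewrite subr_le0 ler_pdivlMr// mul1r. Qed.

(* The exponent 2(j+1) is taken at least p / theta, so that the derivative is controlled by
   the power 1 - theta/p of the profile. *)
Definition profile (s : R) := s `^ (delta / 2) * cutoff s ^+ 2 ^+ j.+1.

Definition dprofile (s : R) := delta / 2 * s `^ (delta / 2 - 1) * cutoff s ^+ 2 ^+ j.+1 +
  s `^ (delta / 2) * (j.+1%:R * cutoff s ^+ 2 ^+ j * (2 * - N^-1 * cutoff s)).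

(** Squaring removes the kink at [s = N]; hence the profile is built from powers of the squared
    cutoff. *)
Lemma is_derive_cutoff2 (s : R) :
  is_derive s (1 : R) (fun s => cutoff s ^+ 2) (2 * - N^-1 * cutoff s).
Proof.
have := is_derive_sqpos_affine (- N^-1) (- 1) s.
rewrite opprK (_ : - N^-1 * s + 1 = 1 - s / N); last by ring.
rewrite (_ : (fun x => sqpos (- N^-1 * x + 1)) = (fun s => cutoff s ^+ 2))//.
by apply/funext => x; rewrite /sqpos /cutoff (_ : - N^-1 * x + 1 = 1 - x / N)//; ring.
Qed.

Lemma is_derive_profile (s : R) : 0 < s -> is_derive s (1 : R) profile (dprofile s).
Proof.
move=> s0; have h1 := is_derive1_powR (delta / 2) s0.
have h2 := is_derive_cutoff2 s.
have h3 : is_derive s (1 : R) (fun s => cutoff s ^+ 2 ^+ j.+1)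
    (j.+1%:R * cutoff s ^+ 2 ^+ j * (2 * - N^-1 * cutoff s)).
  have h := @is_deriveX _ _ _ j.+1 s 1 _ h2.
  have -> : (fun s => cutoff s ^+ 2 ^+ j.+1) = (fun s => cutoff s ^+ 2) ^+ j.+1.
    by apply/funext => y; rewrite fctE.
  apply: (is_derive_eq h).
  by rewrite -[_ *: _]/(_ * _).
have h4 := @is_deriveM _ _ _ _ s 1 _ _ h1 h3.
apply: (@is_derive_eq _ _ _ _ _ _ _ _ h4).
by rewrite /dprofile -![_ *: _]/(_ * _); ring.
Qed.

Definition weight (x : 'rV[R]_d) := profile (jbr x).
Definition dweight (i : 'I_d) (x : 'rV[R]_d) := dprofile (jbr x) * (2 * x ord0 i).

Lemma is_derive_weight i x : is_derive x (delta_mx ord0 i) weight (dweight i x).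
Proof.
apply: is_derive_line; rewrite /weight.
pose q (t : R) := jbr x + 2 * x ord0 i * t + t ^+ 2.
have -> : (fun t : R => profile (jbr (t *: delta_mx ord0 i + x))) = profile \o q.
  by apply/funext => t; rewrite jbr_line.
have q0 : q 0 = jbr x by rewrite /q mulr0 expr0n !addr0.
have dq : is_derive (0 : R) (1 : R) q (2 * x ord0 i).
  apply: (@is_derive_quadratic_remainder _ _ _ _ 1) => y; rewrite /q.
  rewrite (_ : jbr x + 2 * x ord0 i * y + y ^+ 2 - (jbr x + 2 * x ord0 i * 0 + 0 ^+ 2)
     - 2 * x ord0 i * (y - 0) = y ^+ 2); last by ring.
  by rewrite subr0 mul1r ger0_norm ?sqr_ge0.
have dp : is_derive (q 0) (1 : R) profile (dprofile (jbr x)).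
  by rewrite q0; apply: is_derive_profile; exact: jbr_gt0.
exact: is_derive1_comp.
Qed.

Lemma continuous_cutoff : continuous cutoff.
Proof.
rewrite (_ : cutoff = (fun x => Num.max 0 x) \o (fun s => 1 - s / N))// => s.
apply: continuous_comp.
  apply: continuousB; first exact: cvg_cst.
  by apply: continuousM; [exact: cvg_id|exact: cvg_cst].
exact: continuous_pospart.
Qed.

Lemma continuous_powR_gt0 (a s : R) : 0 < s -> {for s, continuous (fun s => s `^ a)}.
Proof.
move=> s0; apply: differentiable_continuous; apply/derivable1_diffP.
by have := is_derive1_powR a s0; case.
Qed.

Lemma continuous_weight : continuous weight.
Proof.
rewrite (_ : weight = profile \o jbr)// => x.
apply: continuous_comp; first exact: continuous_jbr.
apply: differentiable_continuous; apply/derivable1_diffP.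
by have := is_derive_profile (jbr_gt0 x); case.
Qed.

Lemma continuous_dweight i : continuous (dweight i).
Proof.
rewrite (_ : dweight i = ((dprofile \o jbr) * (2 \*: (fun x : 'rV[R]_d => x ord0 i : R^o)))%R)// => x.
apply: continuousM; last first.
  by apply: continuousZr; exact: coord_continuous.
apply: continuous_comp; first exact: continuous_jbr.
have s0 := jbr_gt0 x; have cc := @continuous_cutoff (jbr x).
have cX n : cutoff s ^+ 2 ^+ n @[s --> jbr x] --> cutoff (jbr x) ^+ 2 ^+ n.
  elim: n => [|n IHn].
    by rewrite expr0; under eq_fun do rewrite expr0; exact: cvg_cst.
  rewrite exprS; under eq_fun do rewrite exprS.
  by apply: cvgM => //; apply: cvgM.
rewrite /continuous_at /dprofile; apply: cvgD; apply: cvgM => //.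
- by apply: cvgM; [exact: cvg_cst|exact: continuous_powR_gt0].
- exact: continuous_powR_gt0.
- apply: cvgM; last by apply: cvgM; [exact: cvg_cst|exact: cc].
  by apply: cvgM; [exact: cvg_cst|exact: cX].
Qed.

Lemma weight_ge0 x : 0 <= weight x.
Proof. by rewrite mulr_ge0 ?powR_ge0// exprn_ge0// sqr_ge0. Qed.

Lemma jbr_ge x : N <= enorm x -> N <= jbr x.
Proof.
move=> Nx; apply: le_trans Nx _; rewrite /jbr.
by have := enorm_ge0 x; nra.
Qed.

Lemma weight_out x : N <= enorm x -> weight x = 0.
Proof. by move=> /jbr_ge Nx; rewrite /weight /profile cutoff_eq0// expr0n/= expr0n/= mulr0. Qed.

Lemma dweight_out i x : N <= enorm x -> dweight i x = 0.
Proof.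
move=> /jbr_ge Nx; rewrite /dweight /dprofile cutoff_eq0// expr0n/=.
by rewrite [0 ^+ j.+1]expr0n/= !mulr0 addr0 mul0r.
Qed.

(** Where the cutoff is nonzero, 1 / N <= 1 / s, so differentiating the cutoff costs a factor 1 / s
    just as differentiating the power does, and both terms retain 2j + 1 factors of the cutoff. *)
Lemma dprofile_le s : 1 <= s ->
  `|dprofile s| <= (`|delta| / 2 + 2 * j.+1%:R) * s `^ (delta / 2 - 1) * cutoff s ^+ (j.*2.+1).
Proof.
move=> s1; have s0 : 0 < s by exact: lt_le_trans s1.
have [Ns|sN] := leP N s.
  rewrite /dprofile cutoff_eq0// expr0n/= [0 ^+ j.+1]expr0n/= !mulr0 addr0 normr0.
  by rewrite expr0n/= mulr0.
set q := s `^ (delta / 2 - 1); have q0 : 0 <= q by exact: powR_ge0.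
have qs : s `^ (delta / 2) = q * s.
  by rewrite /q powRB ?lt0r_neq0 ?implybT// powRr1 ?(ltW s0)// divfK// lt0r_neq0.
set e := cutoff s; have e0 : 0 <= e by exact: cutoff_ge0.
have e1 : e <= 1 by apply: cutoff_le1; exact: ltW.
have ee : e ^+ 2 ^+ j * e = e ^+ j.*2.+1 by rewrite -exprM mul2n exprSr.
rewrite /dprofile -/q -/e qs.
have -> : delta / 2 * q * e ^+ 2 ^+ j.+1 + q * s * (j.+1%:R * e ^+ 2 ^+ j * (2 * - N^-1 * e)) =
   q * (e ^+ 2 ^+ j * e) * (delta / 2 * e - 2 * j.+1%:R * (s / N)).
  by rewrite exprS; ring.
rewrite normrM ger0_norm; last by rewrite !mulr_ge0// exprn_ge0// sqr_ge0.
rewrite ee [leLHS]mulrC [leLHS]mulrA.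
apply: ler_wpM2r; first by rewrite exprn_ge0.
apply: ler_wpM2r => //.
apply: le_trans (ler_normB _ _) _; apply: lerD.
  by rewrite !normrM (ger0_norm e0) (@ger0_norm _ 2^-1)// ler_piMr// mulr_ge0.
rewrite normrM ger0_norm ?mulr_ge0// ler_piMr ?mulr_ge0//.
by rewrite ger0_norm ?divr_ge0 ?(ltW s0) ?(ltW N0)// ler_pdivrMr// mul1r ltW.
Qed.

Lemma cutoff_powR s b : 0 <= s -> (j.*2.+2)%:R * b <= j.*2.+1%:R ->
  cutoff s ^+ j.*2.+1 <= (cutoff s ^+ 2 ^+ j.+1) `^ b.
Proof.
move=> s0 bj; have := cutoff_le1 s0; have := cutoff_ge0 s.
rewrite le_eqVlt => /predU1P[<- _|e0 e1]; first by rewrite expr0n/= powR_ge0.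
rewrite -exprM -powR_mulrn ?(ltW e0)// -powR_mulrn ?(ltW e0)// -powRrM.
apply: ger_powR; first by rewrite e0.
by rewrite mul2n doubleS.
Qed.

(** A count of powers of s >= 1: the derivative has size s^((delta-1)/2), since each coordinate is
    at most s^(1/2), and the right-hand side has s^((delta b + r c)/2). *)
Lemma dweight_le_moment (r b c : R) i (x : 'rV[R]_d) :
  0 <= c -> (j.*2.+2)%:R * b <= j.*2.+1%:R -> delta - 1 <= delta * b + r * c ->
  `|dweight i x| <= (`|delta| + 4 * j.+1%:R) * (weight x `^ b * (jbr x `^ (r / 2)) `^ c).
Proof.
move=> c0 bj dr; have s1 := jbr_ge1 x; have s0 := jbr_gt0 x.
have x0 := coord_le_jbr x i.
rewrite /weight /profile powRM ?powR_ge0 ?exprn_ge0 ?cutoff_ge0//.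
set s := jbr x in s1 s0 x0 *.
have dp := dprofile_le s1.
have cp := cutoff_powR (ltW s0) bj.
rewrite /dweight -/s normrM.
have h1 : `|2 * x ord0 i| <= 2 * s `^ 2^-1.
  by rewrite normrM ger0_norm// ler_wpM2l.
apply: le_trans (ler_pM (normr_ge0 _) (normr_ge0 _) dp h1) _.
have -> : (`|delta| / 2 + 2 * j.+1%:R) * s `^ (delta / 2 - 1) * cutoff s ^+ j.*2.+1 *
   (2 * s `^ 2^-1) = (`|delta| + 4 * j.+1%:R) *
     ((s `^ (delta / 2 - 1) * s `^ 2^-1) * cutoff s ^+ j.*2.+1).
  by move: (s `^ 2^-1) (s `^ _) => A B; field.
apply: ler_wpM2l; first by rewrite addr_ge0// mulr_ge0.
rewrite [leRHS]mulrAC; apply: ler_pM => //; rewrite ?mulr_ge0 ?powR_ge0 ?exprn_ge0 ?cutoff_ge0//.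
have sn0 : s != 0 by rewrite lt0r_neq0.
rewrite -!powRrM -!powRD ?sn0 ?implybT//.
by apply: ler_powR => //; lra.
Qed.

(* Plays the role of G for the mass estimate; with c = (theta - 1) / p it tends to 0 as
   N tends to infinity. *)
Definition tail_weight (c : R) (x : 'rV[R]_d) :=
  if jbr x < N then (jbr x `^ 2^-1 / N) `^ c^-1 else 0.

(** For [delta = 0] only the cutoff is differentiated, and the factor |x| / N is kept instead of
    being bounded uniformly in N; the power [c] of [tail_weight] reproduces it up to replacing |x|
    by s^(1/2). *)
Lemma dweight_le_tail (b c : R) i (x : 'rV[R]_d) :
  delta = 0 -> 0 < c -> (j.*2.+2)%:R * b <= j.*2.+1%:R ->
  `|dweight i x| <= 4 * j.+1%:R * (weight x `^ b * tail_weight c x `^ c).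
Proof.
move=> d0 c0 bj; have s1 := jbr_ge1 x; have s0 := jbr_gt0 x.
have x0 := coord_le_jbr x i.
rewrite /tail_weight /dweight /dprofile /weight /profile d0 !mul0r add0r powRr0 !mul1r.
set s := jbr x in s1 s0 x0 *.
have cp := cutoff_powR (ltW s0) bj.
case: ifPn => [sN|]; last first.
  rewrite -leNgt => Ns; rewrite cutoff_eq0// !mulr0 mul0r normr0.
  by rewrite !mulr_ge0 ?powR_ge0.
rewrite -powRrM mulVf ?lt0r_neq0// powRr1; last by rewrite divr_ge0 ?powR_ge0 ?(ltW N0).
have -> : j.+1%:R * cutoff s ^+ 2 ^+ j * (2 * - N^-1 * cutoff s) * (2 * x ord0 i) =
   - (4 * j.+1%:R * (cutoff s ^+ j.*2.+1 * (x ord0 i / N))).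
  have -> : cutoff s ^+ j.*2.+1 = cutoff s ^+ 2 ^+ j * cutoff s.
    by rewrite -exprM mul2n exprSr.
  ring.
rewrite normrN normrM ger0_norm ?mulr_ge0//; apply: ler_wpM2l; first by rewrite mulr_ge0.
rewrite normrM ger0_norm ?exprn_ge0 ?cutoff_ge0//.
apply: ler_pM => //; rewrite ?exprn_ge0 ?cutoff_ge0//.
by rewrite normrM (ger0_norm (_ : 0 <= N^-1)) ?invr_ge0 ?(ltW N0)// ler_wpM2r// invr_ge0 ltW.
Qed.

End truncated_weight.

(** * Interpolation, removal of the truncation, comparison with the moments *)

Lemma powR_doubling (R : realType) (x y e : R) : 0 < x -> 0 < y ->
  x <= 2 * y -> y <= 2 * x -> x `^ e <= 2 `^ `|e| * y `^ e.
Proof.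
move=> x0 y0 xy yx; have [e0|e0] := leP 0 e.
  rewrite ger0_norm// -powRM ?(ltW y0)//.
  by apply: ge0_ler_powR; rewrite ?nnegrE ?mulr_ge0 ?(ltW y0) ?(ltW x0).
rewrite ltr0_norm// -[in x `^ e](opprK e) -[in y `^ e](opprK e).
rewrite (powRN x (- e)) (powRN y (- e)) ler_pdivlMr ?powR_gt0//.
rewrite mulrC ler_pdivrMr ?powR_gt0// -powRM ?(ltW x0)//.
by apply: ge0_ler_powR; rewrite ?nnegrE ?mulr_ge0 ?oppr_ge0 ?(ltW y0) ?(ltW x0) ?(ltW e0).
Qed.

(* Optimising [l] gives the interpolation exponents; the degenerate cases [e = 0] and
   [g = 0] are the limits [l -> +oo] and [l -> 0]. *)
Lemma interpolation_bound (R : realType) (x a A B e g theta : R) :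
  1 < theta -> 0 <= A -> 0 <= B -> 0 <= e -> 0 <= g ->
  (forall l, 0 < l -> x <= a + A * l `^ (theta - 1) * e + B / l * g) ->
  x <= a + (A + B) * (g `^ (1 - theta^-1) * e `^ theta^-1).
Proof.
move=> t1 A0 B0 e0 g0 h.
have t0 : 0 < theta by exact: lt_trans t1.
have tn0 : theta != 0 by rewrite lt0r_neq0.
have t10 : 0 < theta - 1 by rewrite subr_gt0.
have tV : theta^-1 < 1 by rewrite invf_lt1.
have [e00|en0] := eqVneq e 0.
  rewrite e00 powR0 ?invr_eq0// !mulr0 addr0; apply/ler_addgt0Pr => eps eps0.
  have Bg : 0 <= B * g by exact: mulr_ge0.
  have Bg1 : 0 < B * g + 1 by rewrite ltr_wpDl.
  apply: le_trans (h ((B * g + 1) / eps) _) _; first exact: divr_gt0.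
  rewrite e00 mulr0 addr0 lerD2l invf_div mulrAC mulrA ler_pdivrMr// mulrDr mulr1.
  by rewrite (mulrC eps) lerDl ltW.
have [g00|gn0] := eqVneq g 0.
  rewrite g00 powR0 ?subr_eq0 ?(gt_eqF tV)//.
  rewrite !mul0r mulr0 addr0; apply/ler_addgt0Pr => eps eps0.
  have Ae : 0 <= A * e by exact: mulr_ge0.
  have Ae1 : 0 < A * e + 1 by rewrite ltr_wpDl.
  have q0 : 0 < eps / (A * e + 1) by exact: divr_gt0.
  apply: le_trans (h ((eps / (A * e + 1)) `^ (theta - 1)^-1) _) _; first exact: powR_gt0.
  rewrite g00 mulr0 addr0 lerD2l -powRrM mulVf ?lt0r_neq0// powRr1 ?(ltW q0)//.
  rewrite mulrAC mulrA ler_pdivrMr// mulrDr mulr1.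
  by rewrite (mulrC eps) lerDl ltW.
have ep : 0 < e by rewrite lt_neqAle eq_sym en0.
have gp : 0 < g by rewrite lt_neqAle eq_sym gn0.
(* The balancing value l = (g / e)^(1/theta), for which l^(theta-1) e and g / l both equal
   g^(1-1/theta) e^(1/theta). *)
apply: le_trans (h (g `^ theta^-1 * e `^ (- theta^-1)) _) _.
  by rewrite mulr_gt0 ?powR_gt0.
rewrite -addrA lerD2l mulrDl le_eqVlt; apply/orP; left; apply/eqP; congr (_ + _).
  rewrite -mulrA; congr (_ * _).
  have ee : e `^ (- theta^-1 * (theta - 1)) * e = e `^ (- theta^-1 * (theta - 1) + 1).
    by rewrite -{2}(powRr1 (ltW ep)) -powRD ?en0 ?implybT.
  rewrite powRM ?powR_ge0// -!powRrM -mulrA ee.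
  congr (_ `^ _ * _ `^ _); first by rewrite mulrBr mulr1 mulVf.
  by rewrite mulNr mulrBr mulr1 mulVf//; ring.
rewrite -mulrA; congr (_ * _).
have gg : g `^ (- theta^-1) * g = g `^ (- theta^-1 + 1).
  by rewrite -{2}(powRr1 (ltW gp)) -powRD ?gn0 ?implybT.
by rewrite invfM -!powRN opprK mulrAC gg addrC.
Qed.

Section weight_limit.
Context (R : realType) (d : nat).
Implicit Types (x : 'rV[R]_d) (N delta a : R).

Lemma jbr_max_equiv x : jbr x <= 2 * Num.max 1 (enorm x) ^+ 2 /\
  Num.max 1 (enorm x) ^+ 2 <= 2 * jbr x.
Proof.
have := enorm_ge0 x; rewrite /jbr; move: (enorm x) => y y0.
by have [h|h] := leP 1 y; split; nra.
Qed.

Lemma jbr_moment_equiv a x :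
  jbr x `^ (a / 2) <= 2 `^ `|a / 2| * Num.max 1 (enorm x) `^ a /\
  Num.max 1 (enorm x) `^ a <= 2 `^ `|a / 2| * jbr x `^ (a / 2).
Proof.
have m0 : 0 < Num.max 1 (enorm x) by rewrite lt_max ltr01.
have [h1 h2] := jbr_max_equiv x.
have -> : Num.max 1 (enorm x) `^ a = (Num.max 1 (enorm x) ^+ 2) `^ (a / 2).
  by rewrite -powR_mulrn ?(ltW m0)// -powRrM mulrC divfK.
have j0 := jbr_gt0 x.
by split; apply: powR_doubling; rewrite ?exprn_gt0.
Qed.

Lemma measurable_jbr_powR a : measurable_fun setT (fun x : Rd R d => jbr x `^ a).
Proof.
apply: (measurableT_comp (measurable_powR a)).
exact: (continuous_measurable_Rd (@continuous_jbr R d)).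
Qed.

Lemma weight_le delta N j x : 1 <= N -> weight delta N j x <= jbr x `^ (delta / 2).
Proof.
move=> N1; rewrite /weight /profile ler_piMr ?powR_ge0//.
have c0 := cutoff_ge0 N (jbr x).
have c1 := cutoff_le1 N1 (ltW (jbr_gt0 x)).
by rewrite -exprM exprn_ile1.
Qed.

Lemma weight_nondecreasing delta N N' j x : 1 <= N -> N <= N' ->
  weight delta N j x <= weight delta N' j x.
Proof.
move=> N1 NN'; rewrite /weight /profile ler_wpM2l ?powR_ge0//.
rewrite -!exprM lerXn2r ?nnegrE ?cutoff_ge0// /cutoff ge_max le_max lexx/= le_max.
have N0 : 0 < N by exact: lt_le_trans N1.
apply/orP; right; rewrite lerD2l lerN2 ler_wpM2l ?(ltW (jbr_gt0 x))// lef_pV2 ?posrE//.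
exact: lt_le_trans NN'.
Qed.

Lemma cvg_div_nat (y : R) : y / n.+1%:R @[n --> \oo] --> 0.
Proof.
rewrite -[X in _ --> X](mulr0 y); apply: cvgM; first exact: cvg_cst.
exact: cvg_harmonic.
Qed.

Lemma weight_cvg delta j x :
  weight delta n.+1%:R j x @[n --> \oo] --> jbr x `^ (delta / 2).
Proof.
rewrite -[X in _ --> X]mulr1; rewrite /weight /profile.
apply: cvgM; first exact: cvg_cst.
have c1 : cutoff n.+1%:R (jbr x) @[n --> \oo] --> (1 : R).
  have h : 1 - jbr x / n.+1%:R @[n --> \oo] --> (1 : R).
    rewrite -[X in _ --> X]subr0; apply: cvgB; first exact: cvg_cst.
    exact: cvg_div_nat.
  have {2}-> : (1 : R) = Num.max 0 1 by rewrite max_r.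
  by apply: (@cvg_comp _ _ _ (fun n => 1 - jbr x / n.+1%:R) (fun y : R => Num.max 0 y) _ _ _ h); exact: continuous_pospart.
rewrite -[X in _ --> X](expr1n _ j.+1) -{2}(expr1n R 2).
elim: j.+1 => [|k IH].
  by rewrite expr0; under eq_fun do rewrite expr0; exact: cvg_cst.
rewrite exprS; under eq_fun do rewrite exprS.
by apply: cvgM => //; rewrite expr2; under eq_fun do rewrite expr2; apply: cvgM.
Qed.

Lemma weight_integral_cvg (m : {measure set (Rd R d) -> \bar R}) delta j :
  (\int[m]_x (weight delta n.+1%:R j x)%:E @[n --> \oo] -->
   \int[m]_x (jbr x `^ (delta / 2))%:E)%E.
Proof.
have := @cvg_monotone_convergence _ _ _ m setT measurableT
    (fun n (x : Rd R d) => (weight delta n.+1%:R j x)%:E).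
have -> : (fun x0 : Rd R d => limn (fun n => (weight delta n.+1%:R j x0)%:E)) =
     (fun x => (jbr x `^ (delta / 2))%:E).
  apply/funext => x; apply: cvg_lim => //; apply: cvg_EFin; first by near=> n.
  exact: weight_cvg.
apply.
- move=> n; apply/measurable_EFinP; apply: continuous_measurable_Rd.
  exact: continuous_weight.
- by move=> n x _; rewrite lee_fin weight_ge0.
- by move=> x _ n k nk; rewrite lee_fin weight_nondecreasing ?ler1n// ler_nat.
Unshelve. all: end_near. Qed.

End weight_limit.
Section moment_integrals.
Context (R : realType) (d : nat).
Implicit Types (m : {measure set (Rd R d) -> \bar R}) (a : R).
Local Open Scope ereal_scope.

Lemma measurable_max_powR a :
  measurable_fun setT (fun x : Rd R d => ((Num.max 1 (enorm x)) `^ a)%:E).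
Proof.
apply/measurable_EFinP; apply: (measurableT_comp (measurable_powR a)).
by apply: measurable_maxr => //; exact: (continuous_measurable_Rd (@continuous_enorm R d)).
Qed.

Lemma measurable_EFin_jbr_powR a : measurable_fun setT (fun x : Rd R d => (jbr x `^ a)%:E).
Proof. by apply/measurable_EFinP; exact: measurable_jbr_powR. Qed.

Lemma mom_ge0 a m : 0 <= mom a m.
Proof. by apply: integral_ge0 => x _; rewrite lee_fin powR_ge0. Qed.

Lemma mom0 m : mom 0 m = m setT.
Proof.
rewrite /mom; under eq_integral do rewrite powRr0.
by rewrite integral_cst// mul1e.
Qed.

Lemma integral_jbr_le_mom a m :
  \int[m]_x (jbr x `^ (a / 2))%:E <= (2 `^ `|a / 2|)%:E * mom a m.
Proof.
rewrite -ge0_integralZl_EFin ?powR_ge0//; last 2 first.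
- by move=> x _; rewrite lee_fin powR_ge0.
- exact: measurable_max_powR.
apply: ge0_le_lower_integral => x _; rewrite -?EFinM lee_fin ?powR_ge0//.
by case: (jbr_moment_equiv a x).
Qed.

Lemma mom_le_integral_jbr a m :
  mom a m <= (2 `^ `|a / 2|)%:E * \int[m]_x (jbr x `^ (a / 2))%:E.
Proof.
rewrite -ge0_integralZl_EFin ?powR_ge0//; last 2 first.
- by move=> x _; rewrite lee_fin powR_ge0.
- exact: measurable_EFin_jbr_powR.
apply: ge0_le_lower_integral => x _; rewrite -?EFinM lee_fin ?powR_ge0//.
by case: (jbr_moment_equiv a x).
Qed.

End moment_integrals.

(** Supplies the finite, attained maximum that the absorption argument subtracts. *)
Lemma mass_curve_max (R : realType) (d : nat) (T : R)
    (mu sig : R -> {measure set (Rd R d) -> \bar R}) (u : R -> 'rV[R]_d -> 'rV[R]_d)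
    (psi : 'rV[R]_d -> R) (r : R) :
  0 < T -> CE T mu sig u -> continuous psi -> (forall x, r <= enorm x -> psi x = 0) ->
  exists2 c, 0 <= c <= T & forall t, 0 <= t <= T -> mass_curve mu psi t <= mass_curve mu psi c.
Proof.
move=> T0 ce cpsi spsi.
have cm : {within `[0, T], continuous (mass_curve mu psi)}.
  apply/subspace_continuousP => t; rewrite /= in_itv/= => t0.
  rewrite /from_subspace/=; apply/cvgrPdist_lt => e e0.
  have [dl dl0 h] := mass_curve_continuous ce cpsi spsi t0 e0.
  rewrite near_withinE; exists dl => // s /= st; rewrite in_itv/= => s0.
  by rewrite distrC; apply: h => //; rewrite distrC.
have [c] := EVT_max (ltW T0) cm; rewrite in_itv/= => c0 h.
by exists c => // t t0; apply: h; rewrite in_itv.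
Qed.

(** The condition says 2j + 2 >= p / theta, so the Archimedean property provides [j]. *)
Lemma exists_cutoff_exponent (R : realType) (p theta : R) : 0 < theta -> 0 < p ->
  exists j, (j.*2.+2)%:R * (1 - theta / p) <= j.*2.+1%:R.
Proof.
move=> t0 p0; exists (Num.bound (p / theta)); set j := Num.bound _.
have pt : p / theta < j%:R by apply: archi_boundP; rewrite divr_ge0// ltW.
have h : 1 <= j.*2.+2%:R * (theta / p).
  rewrite mulrA ler_pdivlMr// mul1r -ler_pdivrMr//; apply: (le_trans (ltW pt)).
  by rewrite ler_nat -addnn -!addnS leq_addr.
have e : j.*2.+2%:R = j.*2.+1%:R + 1 :> R by rewrite -natr1.
by rewrite mulrBr mulr1 {1}e; lra.
Qed.

(** * The moment estimate *)

Section moments.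
Context (R : realType) (d : nat) (phi : R -> 'rV[R]_d -> R) (p theta T : R).
Hypotheses (p1 : 1 < p) (adm : admissible p phi) (theta1 : 1 < theta)
  (thetap : theta <= p) (hom : homogeneous theta phi) (T0 : 0 < T).

Let p0 : 0 < p. Proof. exact: lt_trans p1. Qed.
Let theta0 : 0 < theta. Proof. exact: lt_trans theta1. Qed.

(** The increment bound is applied at the time [c] of maximal mass, where be = 1 / (2T) turns the
    mass term into half of the maximum; absorbing it doubles all the other terms. The parameter [l]
    stays free for the interpolation. *)
Lemma truncated_mass_bound (c0 K A l N delta : R) j
    (gamma : {measure set (Rd R d) -> \bar R})
    (mu sig : R -> {measure set (Rd R d) -> \bar R}) (u : R -> 'rV[R]_d -> 'rV[R]_d)
    (G : Rd R d -> R) t :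
  CE T mu sig u -> 0 < c0 ->
  (forall rho w, 0 < rho -> c0 * (rho `^ (theta - p) * enorm w `^ p) <= phi rho w) ->
  0 <= K ->
  A = ((d%:R * K + 1) / ((2 * T)^-1 `^ (1 - theta / p))) `^ p / c0 ->
  0 < l -> 1 <= N ->
  measurable_fun setT G -> (forall x, 0 <= G x) ->
  (forall i x, `|dweight delta N j i x| <=
     K * (weight delta N j x `^ (1 - theta / p) * G x `^ ((theta - 1) / p))) ->
  (\int[gamma]_x (G x)%:E < +oo)%E ->
  (energy phi gamma T mu sig u < +oo)%E ->
  0 <= t <= T ->
  mass_curve mu (weight delta N j) t <= 2 * mass_curve mu (weight delta N j) 0 +
    2 * A * l `^ (theta - 1) * fine (energy phi gamma T mu sig u) +
    2 * T / l * fine (\int[gamma]_x (G x)%:E).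
Proof.
move=> ce c00 lb K0 AE l0 N1 mG G0 DK Gfin Efin tI.
have be0 : 0 < (2 * T)^-1 by rewrite invr_gt0 mulr_gt0.
set be := (2 * T)^-1 in be0 AE *.
have bb0 : 0 < be `^ (1 - theta / p) by exact: powR_gt0.
have q0 : 0 < d%:R * K + 1 by rewrite ltr_wpDl// mulr_ge0.
have qb0 : 0 < (d%:R * K + 1) / be `^ (1 - theta / p) by exact: divr_gt0.
have A0 : 0 < A by rewrite AE divr_gt0// powR_gt0.
have al0 : 0 < A * l `^ (theta - 1) by rewrite mulr_gt0// powR_gt0.
have ta0 : 0 < l^-1 by rewrite invr_gt0.
have cpsi := @continuous_weight R d delta N j.
have spsi := @weight_out R d delta N j N1.
have [c cI Mc] := mass_curve_max T0 ce cpsi spsi.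
(* With al proportional to l^(theta-1) and ta = 1 / l the powers of [l] cancel, so one [A] serves
   all [l]. The 1 in d K + 1 keeps [A] positive even when d K = 0. *)
have KP : d%:R * K <= (A * l `^ (theta - 1) * c0) `^ p^-1 *
    (be `^ (1 - theta / p) * l^-1 `^ ((theta - 1) / p)).
  rewrite mulrAC powRM ?mulr_ge0 ?powR_ge0 ?(ltW A0) ?(ltW c00)//.
  have -> : A * c0 = ((d%:R * K + 1) / be `^ (1 - theta / p)) `^ p.
    by rewrite AE divfK// lt0r_neq0.
  rewrite -!powRrM divff ?lt0r_neq0// powRr1 ?(ltW qb0)//.
  rewrite -(powR_inv1 (ltW l0)) -powRrM mulN1r.
  rewrite [leRHS](_ : _ = ((d%:R * K + 1) / be `^ (1 - theta / p) * be `^ (1 - theta / p)) *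
     (l `^ ((theta - 1) / p) * l `^ (- ((theta - 1) / p)))); last by ring.
  rewrite divfK ?lt0r_neq0// -powRD ?lt0r_neq0 ?implybT// subrr powRr0 mulr1.
  by rewrite lerDl.
have inc s : 0 <= s <= T -> _ :=
  energy_increment p1 adm theta1 thetap hom T0 ce (@weight_ge0 R d delta N j) cpsi
    (@continuous_dweight R d delta N j) (@is_derive_weight R d delta N j)
    spsi (@dweight_out R d delta N j N1) c00 lb al0 be0 ta0 KP mG G0 DK Gfin Efin Mc (t := s).
have hc := inc _ cI; have ht := Mc _ tI.
set m0 := mass_curve _ _ 0 in hc *; set mc := mass_curve _ _ c in hc ht.
set E := fine (energy _ _ _ _ _ _) in hc *; set GG := fine _ in hc *.
have Tb : T * (be * mc + l^-1 * GG) = mc / 2 + T / l * GG.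
  by rewrite /be; field; rewrite !lt0r_neq0.
have := le_trans (ler_norm _) hc; rewrite Tb => h.
apply: le_trans ht _.
rewrite -!mulrA !(mulrA A) (mulrA T); lra.
Qed.

Lemma moment_estimate (r delta : R) :
  delta <= p / theta + (1 - theta^-1) * r ->
  exists C3 : R, 0 <= C3 /\
  forall (gamma : {measure set (Rd R d) -> \bar R})
         (mu sig : R -> {measure set (Rd R d) -> \bar R})
         (u : R -> 'rV[R]_d -> 'rV[R]_d),
    (mom r gamma < +oo)%E -> CE T mu sig u ->
    (energy phi gamma T mu sig u < +oo)%E ->
    (mom delta (mu 0%R) < +oo)%E ->
    forall t, 0 <= t <= T ->
      (mom delta (mu t) <=
         (C3 * (fine (mom delta (mu 0%R))
                + fine (mom r gamma) `^ (1 - theta^-1)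
                  * fine (energy phi gamma T mu sig u) `^ (theta^-1)))%:E)%E.
Proof.
move=> dle.
have [c0 c00 lb] := density_lower_bound p1 adm hom.
have [j bj] := exists_cutoff_exponent theta0 p0.
have c_ge0 : 0 <= (theta - 1) / p by rewrite divr_ge0 ?subr_ge0 ?ltW.
(* The assumption on delta multiplied by theta / p is the power count required by
   [dweight_le_moment]. *)
have dr : delta - 1 <= delta * (1 - theta / p) + r * ((theta - 1) / p).
  have : delta * (theta / p) <= (p / theta + (1 - theta^-1) * r) * (theta / p).
    by rewrite ler_wpM2r// divr_ge0// ltW.
  have -> : (p / theta + (1 - theta^-1) * r) * (theta / p) = 1 + r * ((theta - 1) / p).
    by field; rewrite !lt0r_neq0.
  by rewrite mulrBr mulr1; lra.
pose K := `|delta| + 4 * j.+1%:R; have K0 : 0 <= K by rewrite addr_ge0// mulr_ge0.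
pose A := ((d%:R * K + 1) / ((2 * T)^-1 `^ (1 - theta / p))) `^ p / c0.
have A0 : 0 <= A by rewrite divr_ge0 ?powR_ge0// ltW.
pose kd := 2 `^ `|delta / 2| : R; pose kr := 2 `^ `|r / 2| : R.
have kd0 : 0 <= kd by exact: powR_ge0.
have kr0 : 0 <= kr by exact: powR_ge0.
pose B := 2 * A + 2 * T * kr.
have B0 : 0 <= B.
  by apply: addr_ge0; [exact: mulr_ge0|apply: mulr_ge0 => //; apply: mulr_ge0 => //; exact: ltW].
(* The outer [kd] converts the final integral to a moment, the inner one converts the initial moment
   to a weighted mass, the 2 comes from the absorption and [B] from the interpolation. All are fixed
   before the measures. *)
exists (kd * (2 * kd + B)); split; first by rewrite mulr_ge0// addr_ge0// mulr_ge0.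
move=> gamma mu sig u gfin ce Efin m0fin t tI.
have gf : mom r gamma \is a fin_num by rewrite ge0_fin_numE ?mom_ge0.
have m0f : mom delta (mu 0) \is a fin_num by rewrite ge0_fin_numE ?mom_ge0.
pose G (x : Rd R d) := jbr x `^ (r / 2).
have Gle : (\int[gamma]_x (G x)%:E <= (kr * fine (mom r gamma))%:E)%E.
  by rewrite EFinM fineK//; exact: integral_jbr_le_mom.
have Gfin : (\int[gamma]_x (G x)%:E < +oo)%E by rewrite (le_lt_trans Gle) ?ltry.
have E0 : (0 <= energy phi gamma T mu sig u)%E := energy_ge0 T p1 adm theta1 thetap hom gamma mu sig u.
set E := fine (energy _ _ _ _ _ _); have Ef0 : 0 <= E by exact: fine_ge0.
set g := fine (mom r gamma) in Gle *; have g0 : 0 <= g by exact/fine_ge0/mom_ge0.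
set m0 := fine (mom delta (mu 0)); have m00 : 0 <= m0 by exact/fine_ge0/mom_ge0.
have I0 : 0 <= (0 : R) <= T by rewrite lexx ltW.
set X := g `^ _ * E `^ _; have X0 : 0 <= X by rewrite mulr_ge0 ?powR_ge0.
have bound n : (\int[mu t]_x (weight delta n.+1%:R j x)%:E <= (2 * kd * m0 + B * X)%:E)%E.
  have N1 : 1 <= n.+1%:R :> R by rewrite ler1n.
  have cpsi := @continuous_weight R d delta n.+1%:R j.
  have spsi := @weight_out R d delta n.+1%:R j N1.
  rewrite (mass_curveE ce cpsi spsi tI) lee_fin.
  have w0 : mass_curve mu (weight delta n.+1%:R j) 0 <= kd * m0.
    rewrite -lee_fin -(mass_curveE ce cpsi spsi I0) EFinM fineK//.
    apply: le_trans (integral_jbr_le_mom delta (mu 0)).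
    by apply: ge0_le_lower_integral => x _; rewrite lee_fin ?weight_ge0 ?weight_le.
  apply: interpolation_bound => //.
  - by rewrite mulr_ge0.
  - by apply: mulr_ge0 => //; apply: mulr_ge0 => //; exact: ltW.
  move=> l l0.
  have := truncated_mass_bound ce c00 lb K0 (erefl A) l0 N1
    (measurable_jbr_powR (r / 2)) (fun x => powR_ge0 _ _)
    (fun i x => dweight_le_moment N1 i x c_ge0 bj dr) Gfin Efin tI.
  move=> /le_trans; apply; rewrite -/E.
  apply: lerD; first by rewrite lerD2r -mulrA ler_wpM2l.
  have -> : 2 * T * kr / l * g = 2 * T / l * (kr * g) by ring.
  apply: ler_wpM2l; first by rewrite !mulr_ge0// ?invr_ge0 ltW.
  rewrite -lee_fin fineK// ge0_fin_numE//.
  by apply: integral_ge0 => x _; rewrite lee_fin powR_ge0.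
have lim : (\int[mu t]_x (jbr x `^ (delta / 2))%:E <= (2 * kd * m0 + B * X)%:E)%E.
  have cv := @weight_integral_cvg R d (mu t) delta j.
  by apply: (cvge_to_le cv); near=> n; exact: bound.
apply: le_trans (mom_le_integral_jbr delta (mu t)) _.
apply: (@le_trans _ _ (kd%:E * (2 * kd * m0 + B * X)%:E)%E).
  by apply: lee_wpmul2l.
rewrite -EFinM lee_fin -[leRHS]mulrA ler_wpM2l//.
by have := mulr_ge0 kd0 X0; have := mulr_ge0 B0 m00; lra.
Unshelve. all: end_near. Qed.

End moments.

(** * Vanishing tail weight and conservation of mass *)

Section tail_weight.
Context (R : realType) (d : nat).

Lemma tail_weight_ge0 (N c : R) (x : 'rV[R]_d) : 0 <= tail_weight N c x.
Proof. by rewrite /tail_weight; case: ifPn => // _; exact: powR_ge0. Qed.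

Lemma measurable_tail_weight (N c : R) :
  measurable_fun setT (tail_weight N c : Rd R d -> R).
Proof.
have mj : measurable_fun setT (fun x : Rd R d => jbr x).
  exact: (continuous_measurable_Rd (@continuous_jbr R d)).
apply: measurable_fun_ifT => //; first exact: measurable_fun_ltr.
apply: (measurableT_comp (measurable_powR c^-1)).
by apply: measurable_funM => //; exact: measurable_jbr_powR.
Qed.

(** On s < N one has s^(1/2) / N <= s^(-1/2), hence the weight is at most s^(-1/(2c)). With c =
    (theta-1)/p the condition on r reads r >= -p/(theta-1). *)
Lemma tail_weight_le (N c r : R) (x : 'rV[R]_d) : 1 <= N -> 0 < c -> - c^-1 <= r ->
  tail_weight N c x <= jbr x `^ (r / 2).
Proof.
move=> N1 c0 cr; rewrite /tail_weight; case: ifPn => [jN|_]; last exact: powR_ge0.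
have j0 := jbr_gt0 x; have j1 := jbr_ge1 x.
have N0 : 0 < N by exact: lt_le_trans N1.
apply: (@le_trans _ _ ((jbr x `^ (- 2^-1)) `^ c^-1)).
  apply: ge0_ler_powR; rewrite ?nnegrE ?invr_ge0 ?powR_ge0 ?(ltW c0)//.
    by rewrite divr_ge0 ?powR_ge0 ?(ltW N0).
  rewrite ler_pdivrMr//; apply: (@le_trans _ _ (jbr x `^ (- 2^-1) * jbr x)).
    rewrite -{3}(powRr1 (ltW j0)) -powRD ?lt0r_neq0 ?implybT//.
    by rewrite (_ : - 2^-1 + 1 = 2^-1)//; field.
  by rewrite ler_wpM2l ?powR_ge0// ltW.
rewrite -powRrM; apply: ler_powR => //.
by rewrite mulNr mulrC -mulNr ler_wpM2r.
Qed.

Lemma tail_weight_cvg (c : R) (x : 'rV[R]_d) : 0 < c ->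
  tail_weight n.+1%:R c x @[n --> \oo] --> 0.
Proof.
move=> c0; apply/cvgrPdist_lt => e e0.
have cV : 0 < c^-1 by rewrite invr_gt0.
have ec : 0 < e `^ c by exact: powR_gt0.
have /cvgrPdist_lt/(_ _ ec) := @cvg_div_nat R (jbr x `^ 2^-1).
apply: filterS => n; rewrite !sub0r !normrN (ger0_norm (tail_weight_ge0 _ _ _)).
have q0 : 0 <= jbr x `^ 2^-1 / n.+1%:R by rewrite divr_ge0 ?powR_ge0.
rewrite ger0_norm// => h; rewrite /tail_weight; case: ifPn => // _.
have -> : e = (e `^ c) `^ c^-1 by rewrite -powRrM divff ?powRr1 ?(ltW e0)// lt0r_neq0.
by apply: gt0_ltr_powR; rewrite ?nnegrE ?powR_ge0.
Qed.

Lemma tail_weight_integral_cvg (gamma : {measure set (Rd R d) -> \bar R}) (c r : R) :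
  0 < c -> - c^-1 <= r -> (mom r gamma < +oo)%E ->
  (\int[gamma]_x (tail_weight n.+1%:R c x)%:E @[n --> \oo] --> 0)%E.
Proof.
move=> c0 cr gfin.
have ij : gamma.-integrable setT (fun x : Rd R d => (jbr x `^ (r / 2))%:E).
  apply/integrableP; split; first exact: measurable_EFin_jbr_powR.
  under eq_integral do rewrite gee0_abs ?lee_fin ?powR_ge0//.
  apply: le_lt_trans (integral_jbr_le_mom r gamma) _.
  by rewrite -(@fineK _ (mom r gamma)) ?ge0_fin_numE ?mom_ge0// -EFinM ltry.
have [] := @dominated_convergence _ _ _ gamma setT measurableT
   (fun n (x : Rd R d) => (tail_weight n.+1%:R c x)%:E) (cst 0%E)
   (fun x => (jbr x `^ (r / 2))%:E).
- by move=> n; apply/measurable_EFinP; exact: measurable_tail_weight.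
- exact: measurable_cst.
- apply: aeW => x _; apply: cvg_EFin; first by near=> n.
  exact: tail_weight_cvg.
- exact: ij.
- apply: aeW => x n _; rewrite gee0_abs ?lee_fin ?tail_weight_ge0//.
  by apply: tail_weight_le => //; rewrite ler1n.
- by move=> _ _; rewrite integral0.
Unshelve. all: end_near. Qed.

End tail_weight.

(** The moment estimate with delta = 0 first bounds the mass uniformly in time by [M]. The mass term
    of Young's inequality is then a small multiple of [M], and no absorption is required. *)
Lemma mass_conservation (R : realType) (d : nat) (phi : R -> 'rV[R]_d -> R)
    (p theta r T : R) (gamma : {measure set (Rd R d) -> \bar R})
    (mu sig : R -> {measure set (Rd R d) -> \bar R}) (u : R -> 'rV[R]_d -> 'rV[R]_d) (t : R) :
  1 < p -> admissible p phi -> 1 < theta -> theta <= p -> homogeneous theta phi ->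
  0 < T -> 0 <= p / theta + (1 - theta^-1) * r ->
  (mom r gamma < +oo)%E -> CE T mu sig u -> (energy phi gamma T mu sig u < +oo)%E ->
  (mu 0%R setT < +oo)%E -> 0 <= t <= T ->
  (mu t setT < +oo)%E /\ mu t setT = mu 0 setT.
Proof.
move=> p1 adm theta1 thetap hom T0 dbar0 gfin ce Efin m0fin tI.
have p0 : 0 < p by exact: lt_trans p1.
have theta0 : 0 < theta by exact: lt_trans theta1.
have [C3 [C30 mest]] := moment_estimate p1 adm theta1 thetap hom T0 dbar0.
have {}mest := mest _ _ _ _ gfin ce Efin; rewrite !mom0 in mest.
have {}mest := mest m0fin.
set M := C3 * _ in mest.
have mfin s : 0 <= s <= T -> (mu s setT < +oo)%E.
  by move=> /mest h; rewrite -mom0; apply: le_lt_trans h _; rewrite ltry.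
have mfn s : 0 <= s <= T -> mu s setT \is a fin_num.
  by move=> sI; rewrite ge0_fin_numE// mfin.
split; first exact: mfin.
have I0 : 0 <= (0 : R) <= T by rewrite lexx ltW.
rewrite -(fineK (mfn _ tI)) -(fineK (mfn _ I0)); congr (_%:E).
have [c0 c00 lb] := density_lower_bound p1 adm hom.
have [j bj] := exists_cutoff_exponent theta0 p0.
pose c := (theta - 1) / p; have c_gt0 : 0 < c by rewrite divr_gt0// subr_gt0.
(* r + 1/c is the critical exponent times theta / (theta-1), a positive factor. *)
have cr : - c^-1 <= r.
  rewrite -subr_ge0 opprK.
  have -> : r + c^-1 = (p / theta + (1 - theta^-1) * r) * (theta / (theta - 1)).
    by rewrite /c; field; rewrite !lt0r_neq0// subr_gt0.
  by rewrite mulr_ge0// divr_ge0 ?subr_ge0 ?ltW.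
pose w n : 'rV[R]_d -> R := weight 0 n.+1%:R j.
have N1 n : 1 <= n.+1%:R :> R by rewrite ler1n.
have lim0 s : 0 <= s <= T ->
    mass_curve mu (w n) s @[n --> \oo] --> fine (mu s setT).
  move=> sI; apply: fine_cvg; rewrite fineK ?mfn//.
  have := @weight_integral_cvg R d (mu s) 0 j.
  under [in X in _ --> X -> _]eq_integral do rewrite mul0r powRr0.
  by rewrite integral_cst// mul1e.
have M_ge n s : 0 <= s <= T -> mass_curve mu (w n) s <= M.
  move=> sI; rewrite -lee_fin.
  rewrite -(mass_curveE ce (@continuous_weight R d 0 n.+1%:R j) (@weight_out R d 0 n.+1%:R j (N1 n)) sI).
  apply: le_trans (mest _ sI); rewrite /mom.
  apply: ge0_le_lower_integral => x _; rewrite lee_fin ?weight_ge0//.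
  by rewrite powRr0; have := weight_le 0 j x (N1 n); rewrite mul0r powRr0.
have M0 : 0 <= M.
  by apply: le_trans (M_ge 0 _ I0); exact/mass_curve_ge0/weight_ge0.
have E0 := energy_ge0 T p1 adm theta1 thetap hom gamma mu sig u.
set E := fine (energy phi gamma T mu sig u).
have Ef0 : 0 <= E by exact: fine_ge0.
apply/eqP; rewrite -subr_eq0 -normr_le0; apply/ler_addgt0Pr => e e0; rewrite add0r.
have S0 : 0 < E + T * M + 1 by rewrite ltr_wpDl// addr_ge0// mulr_ge0// ltW.
(* One [eta] serves as both al and be, chosen so that eta (E + T M) = e - eta. *)
pose eta := e / (E + T * M + 1); have eta0 : 0 < eta by exact: divr_gt0.
pose K := 4 * j.+1%:R : R; have K0 : 0 <= K by rewrite mulr_ge0.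
pose Q := (eta * c0) `^ p^-1 * eta `^ (1 - theta / p).
have Q0 : 0 < Q by rewrite mulr_gt0 ?powR_gt0// mulr_gt0.
have q0 : 0 < d%:R * K + 1 by rewrite ltr_wpDl// mulr_ge0.
(* Young's condition now dictates [ta], which may be huge as [eta] shrinks; it does not depend on
   [n] and multiplies an integral that tends to 0. *)
pose ta := ((d%:R * K + 1) / Q) `^ c^-1.
have ta0 : 0 < ta by rewrite powR_gt0// divr_gt0.
have KP : d%:R * K <= (eta * c0) `^ p^-1 *
    (eta `^ (1 - theta / p) * ta `^ ((theta - 1) / p)).
  rewrite -/c /ta -powRrM mulVf ?lt0r_neq0// powRr1; last first.
    by rewrite divr_ge0 ?ltW.
  by rewrite mulrA -/Q (mulrC Q) divfK ?lt0r_neq0// lerDl.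
have inc n : `|mass_curve mu (w n) t - mass_curve mu (w n) 0| <=
    eta * E + T * (eta * M + ta * fine (\int[gamma]_x (tail_weight n.+1%:R c x)%:E)).
  have Gfin : (\int[gamma]_x (tail_weight n.+1%:R c x)%:E < +oo)%E.
    apply: (@le_lt_trans _ _ (\int[gamma]_x (jbr x `^ (r / 2))%:E)%E).
      apply: ge0_le_lower_integral => x _; rewrite lee_fin ?tail_weight_ge0//.
      exact: tail_weight_le.
    apply: le_lt_trans (integral_jbr_le_mom r gamma) _.
    by rewrite -(@fineK _ (mom r gamma)) ?ge0_fin_numE ?mom_ge0// -EFinM ltry.
  exact: (energy_increment p1 adm theta1 thetap hom T0 ce (@weight_ge0 R d 0 n.+1%:R j)
    (@continuous_weight R d 0 n.+1%:R j)
    (@continuous_dweight R d 0 n.+1%:R j) (@is_derive_weight R d 0 n.+1%:R j)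
    (@weight_out R d 0 n.+1%:R j (N1 n)) (@dweight_out R d 0 n.+1%:R j (N1 n))
    c00 lb eta0 eta0 ta0 KP (@measurable_tail_weight R d n.+1%:R c)
    (@tail_weight_ge0 R d n.+1%:R c)
    (fun i x => dweight_le_tail (N1 n) i x erefl c_gt0 bj) Gfin Efin (M_ge n) tI).
have liml : `|mass_curve mu (w n) t - mass_curve mu (w n) 0| @[n --> \oo] -->
    `|fine (mu t setT) - fine (mu 0 setT)|.
  by apply: cvg_norm; apply: cvgB; exact: lim0.
have limr : eta * E + T * (eta * M + ta * fine (\int[gamma]_x (tail_weight n.+1%:R c x)%:E))
    @[n --> \oo] --> eta * E + T * (eta * M + ta * 0).
  apply: cvgD; first exact: cvg_cst.
  apply: cvgM; first exact: cvg_cst.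
  apply: cvgD; first exact: cvg_cst.
  apply: cvgM; first exact: cvg_cst.
  exact/fine_cvg/(tail_weight_integral_cvg c_gt0 cr gfin).
apply: le_trans (ler_cvg_to liml limr _) _; first by near=> n; exact: inc.
rewrite mulr0 addr0.
have -> : eta * E + T * (eta * M) = e - eta.
  by rewrite /eta; field; rewrite lt0r_neq0.
by rewrite gerBl ltW.
Unshelve. all: end_near. Qed.

Theorem mainTheorem4 (R : realType) (d : nat) (phi : R -> 'rV[R]_d -> R)
  (p theta r T : R) :
  1 < p -> admissible p phi ->
  1 < theta -> theta <= p -> homogeneous theta phi ->
  0 < T ->
  let dbar := p / theta + (1 - theta^-1) * r in
  (forall delta : R, delta <= dbar ->
     exists C3 : R,
     forall (gamma : {measure set (Rd R d) -> \bar R})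
            (mu sig : R -> {measure set (Rd R d) -> \bar R})
            (u : R -> 'rV[R]_d -> 'rV[R]_d),
       locfin gamma -> (mom r gamma < +oo)%E ->
       CE T mu sig u ->
       (energy phi gamma T mu sig u < +oo)%E ->
       (mom delta (mu 0%R) < +oo)%E ->
       forall t, `[0, T]%classic t ->
         (mom delta (mu t) < +oo)%E /\
         (mom delta (mu t) <=
            (C3 * (fine (mom delta (mu 0%R))
                   + fine (mom r gamma) `^ (1 - theta^-1)
                     * fine (energy phi gamma T mu sig u) `^ (theta^-1)))%:E)%E)
  /\
  (0 <= dbar ->
     forall (gamma : {measure set (Rd R d) -> \bar R})
            (mu sig : R -> {measure set (Rd R d) -> \bar R})
            (u : R -> 'rV[R]_d -> 'rV[R]_d),
       locfin gamma -> (mom r gamma < +oo)%E ->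
       CE T mu sig u ->
       (energy phi gamma T mu sig u < +oo)%E ->
       (mu 0%R setT < +oo)%E ->
       forall t, `[0, T]%classic t ->
         (mu t setT < +oo)%E /\ mu t setT = mu 0%R setT).
Proof.
move=> p1 adm theta1 thetap hom T0 dbar; split => [delta dle|dbar0].
  have [C3 [C30 h]] := moment_estimate p1 adm theta1 thetap hom T0 dle.
  exists C3 => gamma mu sig u _ gfin ce Efin m0fin t; rewrite /= in_itv/= => tI.
  have ht := h _ _ _ _ gfin ce Efin m0fin _ tI.
  by split => //; apply: le_lt_trans ht _; rewrite ltry.
move=> gamma mu sig u _ gfin ce Efin m0fin t; rewrite /= in_itv/= => tI.
exact: (mass_conservation p1 adm theta1 thetap hom T0 dbar0 gfin ce Efin m0fin tI).
Qed.
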